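(* Assume Martin's Axiom for $\sigma$-centered partial orderings. Then none of the implications ''P-point $\Rightarrow$ discrete $\Rightarrow$ scattered $\Rightarrow$ measure zero $\Rightarrow$ nowhere dense'' for ultrafilters on $\omega$ reverses; that is: there is a discrete ultrafilter on $\omega$ that is not a P-point; there is a scattered ultrafilter on $\omega$ that is not discrete; there is a measure zero ultrafilter on $\omega$ that is not scattered; and there is a nowhere dense ultrafilter on $\omega$ that is not measure zero.
   Context: If $I$ is a family of subsets of a set $X$ that contains all singletons and is closed under subsets, an ultrafilter $u$ on $\omega$ is an $I$-ultrafilter if for every $F:\omega\to X$ there is $A\in u$ with $F(A)\in I$. Take $X={}^\omega2$ (the Cantor space, with the product topology and the standard product probability measure $m$). The ultrafilter $u$ is called discrete, scattered, measure zero, or nowhere dense if it is an $I$-ultrafilter for $I$ equal, respectively, to the family of all $Y\subseteq{}^\omega 2$ that are discrete (every point of $Y$ is isolated in the subspace $Y$), scattered (every nonempty subset of $Y$ has a point isolated in that subset), such that the closure $\overline Y$ has $m(\overline Y)=0$, or nowhere dense. An ultrafilter $u$ on $\omega$ is a P-point if for every sequence $\langle A_n:n<\omega\rangle$ of elements of $u$ there is $A\in u$ such that $A\setminus A_n$ is finite for all $n$. Martin's Axiom for $\sigma$-centered partial orderings: for every $\sigma$-centered partial ordering $P$ (a countable union of centered subsets, where a subset is centered if any finitely many of its elements have a common lower bound in $P$) and every family of fewer than $2^{\aleph_0}$ dense subsets of $P$, there is a filter on $P$ meeting all of them. *)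

(* Defs.v *)
From HB Require Import structures.
From mathcomp Require Import all_boot all_order all_algebra.
From mathcomp Require Import zify ring lra.
From mathcomp Require Import all_classical all_reals all_analysis.

Set Implicit Arguments.
Unset Strict Implicit.
Unset Printing Implicit Defensive.

Import Order.TTheory GRing.Theory Num.Theory.
Import numFieldNormedType.Exports.

Local Open Scope classical_set_scope.
Local Open Scope card_scope.
Local Open Scope ring_scope.

Section forcing.
Variables (P : Type) (le : P -> P -> Prop).

Definition is_partial_order : Prop :=
  [/\ (forall p, le p p),
      (forall p q r, le p q -> le q r -> le p r) &
      (forall p q, le p q -> le q p -> p = q)].

Definition centered (C : set P) : Prop :=
  forall S : set P, finite_set S -> S `<=` C ->
    exists p, forall q, S q -> le p q.

Definition sigma_centered : Prop :=
  exists C : nat -> set P,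
    (forall n, centered (C n)) /\ \bigcup_n C n = [set: P].

Definition dense_in (D : set P) : Prop := forall p, exists2 q, D q & le q p.

Definition poset_filter (G : set P) : Prop :=
  [/\ G !=set0,
      (forall p q, G p -> le p q -> G q) &
      (forall p q, G p -> G q -> exists r, [/\ G r, le r p & le r q])].

End forcing.

Definition smaller_than_continuum (T : Type) (A : set T) : Prop :=
  (A #<= [set: set nat]) /\ ~ ([set: set nat] #<= A).

(* The order must be required nonempty: an empty order has no filters, while  *)
(* its empty subset is dense.                                                 *)
Definition MA_sigma_centered : Prop :=
  forall (P : Type) (le : P -> P -> Prop),
    inhabited P -> is_partial_order le -> sigma_centered le ->
  forall DD : set (set P),
    smaller_than_continuum DD -> (forall D, DD D -> dense_in le D) ->
    exists2 G : set P, poset_filter le G & forall D, DD D -> D `&` G !=set0.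

Definition cylinder (n : nat) (x : cantor_space) : set cantor_space :=
  [set y | forall i, (i < n)%N -> y i = x i].

Notation cantor_borel := (g_sigma_algebraType (@open cantor_space)).

Lemma cylinder_le m n x : (m <= n)%N -> cylinder n x `<=` cylinder m x.
Proof. by move=> mn y xy i im; apply: xy; exact: leq_trans im mn. Qed.

Lemma nbhs_cylinder (x : cantor_space) (U : set cantor_space) :
  nbhs x U -> exists n, cylinder n x `<=` U.
Proof.
pose F := filter_from [set: nat] (fun n => cylinder n x).
have FF : Filter F.
  apply: filter_from_filter; first by exists 0%N.
  move=> i j _ _; exists (maxn i j) => // y xy; split; apply: cylinder_le xy.
    exact: leq_maxl.
  exact: leq_maxr.
suff Fx : F --> x by move=> /Fx[n _ nU]; exists n.
apply/cvg_sup => i U' [V [[W oW <-] Wx VU]].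
exists i.+1 => // y xy; apply: VU => /=.
by rewrite xy.
Qed.

Lemma open_cylinder n x : open (cylinder n x).
Proof.
elim: n => [|n IHn].
  by rewrite (_ : cylinder 0 x = setT); [exact: openT|apply/seteqP; split].
rewrite (_ : cylinder n.+1 x =
    cylinder n x `&` (fun y : cantor_space => y n) @^-1` [set x n]); last first.
  apply/seteqP; split=> [y xy|y [xy yn] i].
    by split=> [i ni|]; apply: xy => //; exact: ltnW.
  by rewrite ltnS leq_eqVlt => /predU1P[->|]; [exact: yn|exact: xy].
apply: openI => //; apply: open_comp; last exact: discrete_open.
move=> y _; exact: (@proj_continuous _ (fun _ : nat => bool) n).
Qed.

Lemma cylinder_measurable n x : measurable (cylinder n x : set cantor_borel).
Proof. by apply: sub_sigma_algebra; exact: open_cylinder. Qed.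

Definition cyl (s : seq bool) : set cantor_space :=
  cylinder (size s) (nth false s).

Lemma cylE n x : cylinder n x = cyl (mkseq x n).
Proof.
by apply/seteqP; split=> y xy i; move: (xy i); rewrite size_mkseq => + ni;
  rewrite nth_mkseq//; exact.
Qed.

Lemma open_bigcup_cylinder (U : set cantor_space) : open U ->
  U = \bigcup_(s : seq bool) [set y | cyl s y /\ cyl s `<=` U].
Proof.
move=> oU; apply/seteqP; split=> [x Ux|x [s _ [sx]]]; last exact.
have [n nU] := nbhs_cylinder (open_nbhs_nbhs (conj oU Ux)).
by exists (mkseq x n) => //=; rewrite -cylE; split.
Qed.

Section existence.
Variable R : realType.

(* An existence witness: the image of the uniform distribution on [0, 1[    *)
(* under binary expansion.                                                    *)
Definition digits (x : R) : cantor_borel :=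
  fun n => odd (Num.truncn (2 ^+ n.+1 * x)).

Let code (z : cantor_space) :=
  fix c n := if n is m.+1 then ((c m).*2 + z m)%N else 0%N.

Let code_lt z n : (code z n < 2 ^ n)%N.
Proof. elim: n => //= n; rewrite expnS; case: (z n); lia. Qed.

Let truncn_double (y : R) : 0 <= y -> (Num.truncn (2 * y))./2 = Num.truncn y.
Proof.
move=> y0; symmetry; apply: truncn_def.
have /truncn_itv/andP[] : 0 <= 2 * y by lra.
set k := Num.truncn _ => k1 k2.
have kE : k%:R = (odd k)%:R + k./2%:R * 2 :> R.
  by rewrite -{1}(odd_double_half k) natrD -muln2 natrM.
have [r0 r1] : 0 <= (odd k)%:R :> R /\ (odd k)%:R <= 1 :> R.
  by case: (odd k) => /=; split; lra.
move: k2; rewrite -!natr1 => k2.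
by apply/andP; split; lra.
Qed.

Let digits_code x z n : 0 <= x < 1 ->
  cylinder n z (digits x) <-> Num.truncn (2 ^+ n * x) = code z n.
Proof.
move=> /andP[x0 x1]; elim: n => [|n IHn] /=.
  split=> // _; apply: truncn_def; rewrite expr0 mul1r x0/=; lra.
have E : Num.truncn (2 ^+ n.+1 * x) =
    ((Num.truncn (2 ^+ n * x)).*2 + digits x n)%N.
  rewrite -(@truncn_double (2 ^+ n * x)) ?mulr_ge0 ?exprn_ge0//.
  by rewrite mulrA -exprS addnC -[LHS]odd_double_half.
rewrite E; split=> [zx|].
  rewrite (_ : digits x n = z n); last by apply: zx.
  by rewrite IHn.1// => i ni; apply: zx; rewrite ltnS ltnW.
move=> H.
have zE : digits x n = z n.
  by move/(congr1 odd): H; rewrite !oddD !odd_double/= !oddb.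
move: H; rewrite zE => /addIn/double_inj/IHn zx i.
rewrite ltnS leq_eqVlt => /predU1P[->//|]; exact: zx.
Qed.

Let preimage_cylinder z n : digits @^-1` cylinder n z `&` `[0, 1[ =
  `[(code z n)%:R / 2 ^+ n, (code z n).+1%:R / 2 ^+ n[%classic.
Proof.
have p0 : 0 < 2 ^+ n :> R by rewrite exprn_gt0.
apply/seteqP; split=> x /=; rewrite !in_itv/= ler_pdivrMr// ltr_pdivlMr//.
  move=> [zx x01]; rewrite ![x * _]mulrC -((digits_code z n x01).1 zx).
  by apply: truncn_itv; rewrite mulr_ge0 ?(ltW p0)//; case/andP: x01.
move=> /andP[zx xz].
have x01 : 0 <= x < 1.
  apply/andP; split.
    by rewrite -(pmulr_lge0 _ p0) (le_trans _ zx).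
  rewrite -(ltr_pM2r p0) mul1r (lt_le_trans xz)// -natrX ler_nat.
  exact: code_lt.
split=> //; apply/(digits_code z n x01); apply: truncn_def.
by rewrite mulrC zx.
Qed.

Lemma measurable_itv01 : measurable (`[0, 1[%classic : set (measurableTypeR R)).
Proof. exact: measurable_itv. Qed.

Definition digitsT (x : measurableTypeR R) : cantor_borel :=
  digits (if 0 <= x < 1 then x else 0).

Let measurable_digits : measurable_fun setT digitsT.
Proof.
have H n z : measurable (digitsT @^-1` cylinder n z).
  rewrite (_ : _ @^-1` _ = (digits @^-1` cylinder n z `&` `[0, 1[) `|`
      (~` `[0, 1[ `&` [set _ | cylinder n z (digits 0)])); last first.
    apply/seteqP; split=> x; rewrite /digitsT /= in_itv/=; case: ifPn => x01.
    - by left.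
    - by right; split=> //; exact/negP.
    - by move=> [[]//|[]].
    - by move=> [[]//|[]].
  apply: measurableU; first by rewrite preimage_cylinder; exact: measurable_itv.
  apply: measurableI; first by apply: measurableC; exact: measurable_itv.
  have [h|h] := pselect (cylinder n z (digits 0)).
    by rewrite (_ : [set _ | _] = setT)//; apply/seteqP; split.
  by rewrite (_ : [set _ | _] = set0)//; apply/seteqP; split.
apply: (@measurability _ _ _ _ setT digitsT (@open cantor_space) erefl).
move=> _ [U oU <-]; rewrite setTI (open_bigcup_cylinder oU) preimage_bigcup.
apply: countable_bigcupT_measurable; first exact: countableP.
move=> s; have [h|h] := pselect (cyl s `<=` U).
  rewrite (_ : [set y | _] = cyl s); first exact: H.
  by apply/seteqP; split=> // y [].
rewrite (_ : [set y | _] = set0); first by rewrite preimage_set0.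
by apply/seteqP; split=> // y [].
Qed.

Definition lebesgue01 : set (measurableTypeR R) -> \bar R :=
  mrestr (@lebesgue_measure R) measurable_itv01.

HB.instance Definition _ := Measure.copy lebesgue01
  (mrestr (@lebesgue_measure R) measurable_itv01).

Let lebesgue01_setT : lebesgue01 setT = 1%E.
Proof.
rewrite /lebesgue01 /mrestr setTI.
by rewrite lebesgue_measure_itv/= lte_fin ltr01 oppr0 adde0.
Qed.

HB.instance Definition _ :=
  Measure_isProbability.Build _ _ _ lebesgue01 lebesgue01_setT.

HB.instance Definition _ :=
  isMeasurableFun.Build _ _ _ _ digitsT measurable_digits.

Lemma cantor_measure_exists : exists m : probability cantor_borel R,
  forall n x, m (cylinder n x) = ((2 ^+ n)^-1)%:E.
Proof.
exists (distribution lebesgue01 digitsT) => n z.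
rewrite /distribution /pushforward /= /lebesgue01 /mrestr.
rewrite (_ : _ `&` _ = digits @^-1` cylinder n z `&` `[0, 1[); last first.
  by apply/seteqP; split=> x [] /[swap]; rewrite /digitsT /= in_itv/= => ->.
rewrite preimage_cylinder lebesgue_measure_itv/= lte_fin.
rewrite ltr_pM2r ?invr_gt0 ?exprn_gt0// ltr_nat ltnSn -EFinB.
by rewrite -mulrBl -natrB// subSnn mul1r.
Qed.

End existence.

(* The product of the fair-coin measures on {0, 1}: by cantor_measure_unique,  *)
(* its values on cylinders determine it on all Borel sets.                    *)
Definition cantor_measure (R : realType) : probability cantor_borel R :=
  sval (cid (cantor_measure_exists R)).

Lemma cantor_measure_cylinder (R : realType) n x :
  cantor_measure R (cylinder n x) = ((2 ^+ n)^-1)%:E.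
Proof. by rewrite /cantor_measure; case: cid. Qed.

Lemma cantor_measure_unique (R : realType) (m : probability cantor_borel R) :
  (forall n x, m (cylinder n x) = ((2 ^+ n)^-1)%:E) ->
  forall A : set cantor_borel, measurable A -> m A = cantor_measure R A.
Proof.
move=> mE A mA.
pose G : set (set cantor_borel) :=
  [set B | B = set0 \/ exists n x, B = cylinder n x].
have GU : measurable = <<s G >> :> set (set cantor_borel).
  apply/seteqP; split.
    apply: smallest_sub; first exact: smallest_sigma_algebra.
    move=> U oU; rewrite (open_bigcup_cylinder oU).
    apply: (@countable_bigcupT_measurable _ (g_sigma_algebraType G)).
      exact: countableP.
    move=> t; have [h|h] := pselect (cyl t `<=` U).
      rewrite (_ : [set y | _] = cyl t).
        by apply: sub_sigma_algebra; right; exists (size t), (nth false t).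
      by apply/seteqP; split=> // y [].
    rewrite (_ : [set y | _] = set0); first exact: measurable0.
    by apply/seteqP; split=> // y [].
  apply: smallest_sub; first exact: sigma_algebra_measurable.
  by move=> B [->|[n [x ->]]]; [exact: measurable0|exact: cylinder_measurable].
apply: (measure_unique G (fun=> setT)) => //.
- move=> B C [->|[n [x ->]]]; first by rewrite set0I; left.
  move=> [->|[p [y ->]]]; first by rewrite setI0; left.
  have [->|/set0P[z [xz yz]]] := eqVneq (cylinder n x `&` cylinder p y) set0.
    by left.
  right; exists (maxn n p), z; apply/seteqP; split=> [t [xt yt] i|t zt].
    by rewrite leq_max => /orP[] ip; [rewrite xt// xz|rewrite yt// yz].
  by split=> i ip; rewrite zt ?leq_max ?ip ?orbT//; [exact: xz|exact: yz].
- by move=> _; right; exists 0%N, point; apply/seteqP; split.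
- by rewrite bigcup_const//; exists 0%N.
- move=> B [->|[n [x ->]]]; first by rewrite !measure0.
  exact: (etrans (mE n x) (esym (cantor_measure_cylinder R n x))).
- move=> _; apply: (le_lt_trans (probability_le1 m measurableT)).
  by rewrite ltry.
Qed.

Definition I_ultrafilter (X : Type) (I : set (set X)) (u : set_system nat) :
    Prop :=
  UltraFilter u /\ forall F : nat -> X, exists2 A, u A & I (F @` A).

Definition discrete_set (Y : set cantor_space) : Prop := Y `<=` isolated Y.

Definition scattered_set (Y : set cantor_space) : Prop :=
  forall Z : set cantor_space, Z `<=` Y -> Z !=set0 -> isolated Z !=set0.

Definition measure_zero_set (R : realType) (Y : set cantor_space) : Prop :=
  cantor_measure R (closure Y) = 0%E.

Definition nowhere_dense_set (Y : set cantor_space) : Prop :=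
  interior (closure Y) = set0.

Definition P_point (u : set_system nat) : Prop :=
  UltraFilter u /\
  forall A : nat -> set nat, (forall n, u (A n)) ->
    exists2 B, u B & forall n, finite_set (B `\` A n).

Definition discrete_ultrafilter := I_ultrafilter discrete_set.
Definition scattered_ultrafilter := I_ultrafilter scattered_set.
Definition measure_zero_ultrafilter (R : realType) :=
  I_ultrafilter (measure_zero_set R).
Definition nowhere_dense_ultrafilter := I_ultrafilter nowhere_dense_set.

(* Main.v *)
(* Everything rests on one recursion of length continuum. Call a family Pos   *)
(* of subsets of a countable set the positive sets of a proper ideal.         *)
(* Suppose that, whenever fewer than continuum many sets have positive finite *)
(* intersections and F is a map into the Cantor space, Martin's Axiom gives   *)
(* some S that meets all these intersections in a positive set and on which F *)
(* is tame. Then there is an ultrafilter of positive sets on which every F is *)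
(* tame somewhere. The forcing builds S from finite pieces, confines the      *)
(* remaining points to a region F^-1(U) with a countable code for U, and      *)
(* makes finitely many promises; conditions with the same finite piece and    *)
(* code are compatible, so the order is sigma-centered.                       *)
(*                                                                            *)
(* - Pos = infinite sets, tame = convergent: this yields a P-point u.         *)
(* - Pos = sets with a nonempty crowded subset in a copy of the rationals,    *)
(*   tame = image with null closure: measure zero but not scattered.          *)
(* - Pos = sets of positive upper density in the levels of the binary tree,   *)
(*   whose closures have positive measure, tame = nowhere dense image:        *)
(*   nowhere dense but not measure zero.                                      *)
(*                                                                            *)
(* The remaining two ultrafilters need only u. The square of u is discrete    *)
(* but not a P-point. The u-limit of the powers u^n on finite sequences is    *)
(* scattered, since P-point limits preserve scatteredness; in the topology    *)
(* where s^k tends to s as k grows, almost every s in one of its sets is a    *)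
(* limit of longer sequences in that set, so it is not discrete.              *)
Require Import Defs.
From mathcomp Require Import all_boot all_order all_algebra.
From mathcomp Require Import lra.
From mathcomp Require Import all_classical wochoice all_reals all_analysis.

Set Implicit Arguments.
Unset Strict Implicit.
Unset Printing Implicit Defensive.

Import Order.TTheory GRing.Theory Num.Theory.
Import numFieldNormedType.Exports.

Local Open Scope classical_set_scope.

(** * Cardinals below the continuum *)

(** The recursion is [ultrafilter_construction], Martin's Axiom enters through [forcing], and the
    three instances are [convergent_ultrafilter], [null_ultrafilter] and [nwd_ultrafilter]. Tameness
    comes from shrinking the region; positivity comes from adding points, guided in the last two
    instances by promises that no shrinking may break. The limits along the P-point are treated by
    [square_discrete], [scattering_lim] and [upow_lim_not_discrete]; [I_ultrafilter_transfer]
    carries the last three separations over to the natural numbers. *)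

Definition embeds (X Y : Type) : Prop := exists f : X -> Y, injective f.

Lemma embeds_trans (X Y Z : Type) : embeds X Y -> embeds Y Z -> embeds X Z.
Proof. by move=> [f fI] [g gI]; exists (g \o f); exact: inj_comp. Qed.

Lemma embeds_nat (X : countType) : embeds X nat.
Proof. by exists pickle; exact: (pcan_inj pickleK). Qed.

Lemma embeds_pair (X X' Y : Type) : embeds X X' -> embeds (X * Y) (X' * Y).
Proof.
by move=> [f fI]; exists (fun p => (f p.1, p.2)) => -[a b] [c d] [/fI-> ->].
Qed.

Lemma embeds_seq (X Y : Type) : embeds X Y -> embeds (seq X) (seq Y).
Proof. by move=> [f fI]; exists (map f); exact: inj_map. Qed.

(* König: the cofinality of the continuum is uncountable. *)
Lemma embeds_nat_prod (Y : Type) :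
  embeds (set nat) (nat * Y) -> embeds (set nat) Y.
Proof.
move=> [f fI]; apply: contrapT => nY.
pose glue (h : nat -> set nat) : set nat := [set k | exists n m,
  k = pickle (n, m) /\ h n m].
have glueI : injective glue.
  have glueE h n m : glue h (pickle (n, m)) <-> h n m.
    split=> [[n' [m' [/(pcan_inj pickleK)[-> ->]]]]//|hnm].
    by exists n, m.
  move=> h h' hh; apply/funext => n; apply/seteqP; split=> m /glueE.
    by rewrite hh => /glueE.
  by rewrite -hh => /glueE.
(* Otherwise every [z] is the [n]-th entry of some [h] whose image has first component [n], and the
   second components embed the reals in [Y]. Gluing the [z] of all [n] gives the contradiction. *)
have H n : exists z, forall h, (f (glue h)).1 = n -> h n <> z.
  apply: contrapT => /forallNP H; apply: nY.
  have /choice[h hP] z : exists h, (f (glue h)).1 = n /\ h n = z.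
    by apply: contrapT => K; apply: (H z) => h h1 h2; apply: K; exists h.
  exists (fun z => (f (glue (h z))).2) => z z' e.
  have {}e : f (glue (h z)) = f (glue (h z')).
    apply: injective_projections => //; by rewrite (hP z).1 (hP z').1.
  by rewrite -(hP z).2 -(hP z').2 (glueI _ _ (fI _ _ e)).
have /choice[z zP] := H.
exact: (zP (f (glue z)).1 z).
Qed.

(** The bound is on finite sequences because the forcing has dense sets for every finite list of
    earlier sets; in this form [seq X] never has to be compared with [X]. *)
Definition small (X : Type) : Prop := ~ embeds (set nat) (seq X).

Lemma isSome_pmap_inj (X : Type) (s t : seq (option X)) :
  map isSome s = map isSome t -> pmap id s = pmap id t -> s = t.
Proof.
by elim: s t => [|[x|] s IHs] [|[y|] t]//= [/IHs{}IHs] => [[-> /IHs->]|/IHs->].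
Qed.

(** A list of lists is determined by the single list of its proper entries and one of countably many
    patterns; König absorbs the countable factor. *)
Lemma small_seqE (X : Type) : small X ->
  ~ embeds (set nat) (seq (seq (option X))).
Proof.
move=> sX H; apply: sX; apply/embeds_nat_prod/(embeds_trans H).
apply: embeds_trans (embeds_pair _ (embeds_nat (seq (seq bool)))).
exists (fun s => (map (map isSome) s, pmap id (flatten s))) => s t [e1 e2].
have e : flatten s = flatten t.
  by apply: isSome_pmap_inj => //; rewrite !map_flatten e1.
rewrite -(flattenK s) -(flattenK t) e; congr reshape.
have shE u : shape u = shape (map (map (@isSome X)) u).
  by rewrite /shape -map_comp; apply: eq_map => v /=; rewrite size_map.
by rewrite shE e1 -shE.
Qed.

Definition strict_well_order (K : Type) (lt : K -> K -> Prop) : Prop :=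
  [/\ well_founded lt, (forall i j k, lt i j -> lt j k -> lt i k) &
      (forall i j, lt i j \/ i = j \/ lt j i)].

Lemma strict_well_order_exists (K : eqType) :
  exists lt : K -> K -> Prop, strict_well_order lt.
Proof.
have [R Rwo] := well_ordering_principle K.
have Rwo' : wo_chain R predT by move=> A _; exact: Rwo.
have Rr x : R x x by exact: (wo_chain_reflexive Rwo').
have Ra x y : R x y -> R y x -> x = y.
  by move=> xy yx; apply: (wo_chain_antisymmetric Rwo') => //; rewrite xy yx.
have Rt x y : R x y \/ R y x by apply/orP; exact: (wo_chainW Rwo').
have min (A : set K) : A !=set0 -> exists2 z, A z & forall x, A x -> R z x.
  move=> [a Aa]; have [|z [[zA zmin] _]] := Rwo (fun x => `[<A x>]).
    by exists a; apply/asboolP.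
  by exists z => [|x Ax]; [apply/asboolP|apply: zmin; apply/asboolP].
exists (fun x y => R x y /\ x <> y); split.
- move=> x; apply: contrapT => nx.
  have [z nz zmin] := min [set y | ~ Acc (fun x y => R x y /\ x <> y) y]
    (ex_intro _ x nx).
  apply: nz; constructor => y [yz neq]; apply: contrapT => ny; apply: neq.
  by apply: Ra => //; exact: zmin.
- move=> i j k [ij nij] [jk njk].
  have [|z zA zmin] := min [set z | z = i \/ z = j \/ z = k].
    by exists i; left.
  have ik : R i k.
    case: zA => [<-|[zj|zk]]; first by apply: zmin; right; right.
      by have := zmin i (or_introl erefl); rewrite zj => /(Ra _ _ ij)/nij.
    by have := zmin j (or_intror (or_introl erefl)); rewrite zk => /(Ra _ _ jk)/njk.
  split=> // ki; apply: nij; apply: Ra => //; subst k; exact: jk.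
- move=> i j; have [->|/eqP ij] := eqVneq i j; first by right; left.
  by case: (Rt i j) => ?; [left|right; right]; split=> //; exact/nesym.
Qed.

Lemma wf_min (K : Type) (lt : K -> K -> Prop) (P : K -> Prop) :
  well_founded lt -> (exists k, P k) ->
  exists2 k, P k & forall j, lt j k -> ~ P j.
Proof.
move=> wf [k Pk]; apply: contrapT => H; elim: k / (wf k) Pk => k _ IHk Pk.
by apply: H; exists k => // j /IHk.
Qed.

(* If the initial segment below [k0] is the first one whose finite sequences  *)
(* are as many as the reals, the reals embed by [g] into these sequences; they *)
(* are then ordered by the maximal entry of [g k] first. No cardinal           *)
(* arithmetic beyond König's theorem is needed.                                *)
Lemma small_well_order : exists lt : set nat -> set nat -> Prop,
  strict_well_order lt /\ forall k, small {j | `[< lt j k >]}.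
Proof.
have [lt [wf tr tot]] := strict_well_order_exists (set nat).
have [allS|/existsNP/(wf_min wf)[k0 k0P k0min]] :=
  pselect (forall k, small {j | `[< lt j k >]}); first by exists lt.
move: k0P => /contrapT[g gI].
have irr x : ~ lt x x by elim: x / (wf x) => x _ IHx xx; exact: (IHx x).
have [l0 _] : exists l0 : {j | `[< lt j k0 >]}, True.
  apply: contrapT => /forallNP H.
  have gE k : g k = [::] by case: (g k) => // x; case: (H x).
  have /gI/seteqP[/(_ 0%N)] : g setT = g set0 by rewrite !gE.
  by move=> /(_ I).
pose mx := foldr (fun (x : {j | `[< lt j k0 >]}) y =>
  if `[< lt y (val x) >] then val x else y) (val l0).
pose h k := mx (g k).
have hlt k : lt (h k) k0.
  rewrite /h; elim: (g k) => [|x s IHs] /=; first exact/asboolP/(valP l0).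
  by case: asboolP => // _; exact/asboolP/(valP x).
have hge k x : x \in g k -> ~ lt (h k) (val x).
  rewrite /h; elim: (g k) => //= y s IHs; rewrite inE => /predU1P[->|/IHs{}IHs].
    by case: asboolP => // _ /irr.
  by case: asboolP => // yx xy; apply: IHs; exact: tr xy.
pose lt1 j k := lt (h j) (h k) \/ (h j = h k /\ lt j k).
exists lt1; split.
  split.
  - move=> k; move hk : (h k) => m.
    elim: m / (wf m) k hk => m _ IHm k; elim: k / (wf k) => k _ IHk hk.
    constructor => j [jk|[jk ltjk]].
      by apply: IHm; [|reflexivity]; rewrite -hk.
    by apply: IHk => //; rewrite jk.
  - move=> i j k [ij|[eij ij]] [jk|[ejk jk]].
    + by left; exact: tr jk.
    + by left; rewrite -ejk.
    + by left; rewrite eij.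
    + by right; split; [rewrite eij|exact: tr jk].
  - move=> i j; case: (tot (h i) (h j)) => [|[e|]].
    + by left; left.
    + case: (tot i j) => [?|[->|?]]; [by left; right|by right; left|].
      by right; right; right.
    + by right; right; left.
move=> k H; have /contrapT/small_seqE := k0min _ (hlt k); apply.
apply: embeds_trans H _; apply: embeds_seq.
(* For [i] below [k], the entries of [g i] are at most [h k]. Only the value [h k] itself becomes
   [None], so [g i], hence [i], can be recovered. *)
pose q (x : {j | `[< lt j k0 >]}) : option {j | `[< lt j (h k) >]} := insub (val x).
exists (fun j => map q (g (val j))) => -[i ik] [j jk] /= e.
apply: val_inj => /=; apply: gI.
have hle i' : `[< lt1 i' k >] -> forall x, x \in g i' ->
    lt (val x) (h k) \/ val x = h k.
  move=> /asboolP[] hi x xi; case: (tot (val x) (h k)) => [|[|kx]];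
    try by [left|right].
    by case: (hge _ _ xi); exact: tr kx.
  by case: (hge _ _ xi); rewrite hi.1.
have {}hi := hle _ ik; have {}hj := hle _ jk.
elim: (g i) (g j) hi hj e => [|x s IHs] [|y t]//= hx hy [xy st].
congr (_ :: _); last first.
  by apply: IHs => // z zs; [apply: hx|apply: hy]; rewrite inE zs orbT.
have hx0 := hx x (mem_head _ _); have hy0 := hy y (mem_head _ _).
apply: val_inj; move: xy; rewrite /q.
case: insubP => [u _ ux|/asboolP nx]; case: insubP => [v _ vy|/asboolP ny] //.
  by move=> [uv]; rewrite -ux -vy uv.
move=> _; case: hx0 => [/nx//|ex]; case: hy0 => [/ny//|ey].
exact: etrans ex (esym ey).
Qed.

(** * Martin's Axiom *)

(** The keys with [None] record the length, which trailing empty sets would hide. *)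
Lemma embeds_seq_set : embeds (seq (set nat)) (set nat).
Proof.
pose entry (s : seq (set nat)) i (o : option nat) :=
  (i < size s)%N /\ if o is Some n then nth set0 s i n else True.
pose enc s : set nat := [set k | exists i o, k = pickle (i, o) /\ entry s i o].
have encE s i o : enc s (pickle (i, o)) <-> entry s i o.
  split=> [[i' [u [/(pcan_inj pickleK)[-> ->]]]]//|h].
  by exists i, o.
exists enc => s t st.
have H i o : entry s i o <-> entry t i o.
  by split=> /encE; [rewrite st|rewrite -st] => /encE.
have sz : size s = size t.
  apply/eqP; rewrite eqn_leq; apply/andP; split; rewrite leqNgt; apply/negP => lt_sz.
    have /H[] : entry s (size t) None by [].
    by rewrite ltnn.
  have /H[] : entry t (size s) None by [].
  by rewrite ltnn.
apply: (@eq_from_nth _ set0) => // i si; apply/seteqP; split=> n h.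
  by have /H[] : entry s i (Some n) by [].
by have /H[] : entry t i (Some n) by rewrite /entry -sz.
Qed.

(** The fibres of the label [c] are centered, since finitely many conditions can be merged one at a
    time without changing the label. *)
Lemma MA_generic (P J : Type) (V : set P) (le : P -> P -> Prop) (c : P -> nat)
    (D : J -> set P) :
  MA_sigma_centered -> V !=set0 ->
  (forall p, le p p) -> (forall p q r, le p q -> le q r -> le p r) ->
  (forall p q, V p -> V q -> c p = c q ->
     exists r, [/\ V r, c r = c p, le r p & le r q]) ->
  embeds J (set nat) -> ~ embeds (set nat) J ->
  (forall i p, V p -> exists q, [/\ V q, D i q & le q p]) ->
  exists G : set P, [/\ G `<=` V,
    (forall p q, G p -> G q -> exists r, [/\ G r, le r p & le r q]) &
    forall i, exists2 p, G p & D i p].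
Proof.
move=> MA [p0 Vp0] lexx le_tr cent [jI jI_inj] nJ dense.
have /choice[ch chP] (S : set P) : exists p, S !=set0 -> S p.
  by have [[p Sp]|] := pselect (S !=set0); [exists p|exists p0].
(* Canonical representatives make the preorder antisymmetric. *)
pose canon p := ch [set q | [/\ V q, le p q & le q p]].
have canonP p : V p -> [/\ V (canon p), le p (canon p) & le (canon p) p].
  by move=> Vp; apply: (chP [set q | [/\ V q, le p q & le q p]]); exists p.
have canon_eq p q : le p q -> le q p -> canon p = canon q.
  move=> pq qp; congr ch; apply/seteqP; split=> r [Vr h1 h2]; split=> //.
  - exact: le_tr qp h1.
  - exact: le_tr h2 pq.
  - exact: le_tr pq h1.
  - exact: le_tr h2 qp.
pose Q := {classic {p | V p /\ canon p = p}}.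
have canonK p : V p -> V (canon p) /\ canon (canon p) = canon p.
  by move=> /canonP[Vc h1 h2]; split=> //; exact: canon_eq.
pose toQ p (Vp : V p) : Q := exist _ (canon p) (canonK p Vp).
pose leQ (p q : Q) := le (sval p) (sval q).
have QV (p : Q) : V (sval p) by case: p => p [].
(* [D i] may distinguish equivalent conditions, so it is replaced by all that lies below it; the
   filter is later enlarged to the valid conditions above it. *)
pose E i : set Q := [set p | exists q, [/\ V q, D i q & le (sval p) q]].
have [|||||G [Gne Gup Gdir] GE] := MA Q leQ _ _ _ (range E).
- by constructor; exact: (toQ p0 Vp0).
- split=> [p|p q r|]; [exact: lexx|exact: le_tr|].
  move=> [p [Vp ep]] [q [Vq eq]] /= pq qp.
  have pqE : p = q by rewrite -ep -eq; exact: canon_eq.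
  by subst q; congr exist; exact: Prop_irrelevance.
- exists (fun n => [set p | c (sval p) = n]); split; last first.
    by apply/seteqP; split=> // p _; exists (c (sval p)).
  move=> n S /finite_seqP[s ->] sC.
  have [r [Vr rs]] : exists r, [/\ V r, (s = [::] \/ c r = n) &
      forall p : Q, p \in s -> le r (sval p)].
    elim: s sC => [|q s IHs] sC; first by exists p0; split=> //; left.
    have cq : c (sval q) = n by apply: (sC q); exact: mem_head.
    have [|r [Vr cr rs]] := IHs.
      by move=> t ts; apply: sC; rewrite /= inE ts orbT.
    case: cr => [s0|cr].
      exists (sval q); split; [exact: (QV q)|by right|].
      by move=> t; rewrite s0 mem_seq1 => /eqP ->.
    have [|r' [Vr' cr' r'r r'q]] := cent r (sval q) Vr (QV q).
      by rewrite cr cq.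
    exists r'; split=> //; first by right; rewrite cr'.
    by move=> t; rewrite inE => /predU1P[->//|/rs]; exact: le_tr.
  move=> rs'; exists (toQ r Vr) => t /rs'; apply: le_tr.
  by have [] := canonP _ Vr.
- split; last first.
    move=> /pcard_leP/injfunPex[f fE fI]; apply: nJ.
    have /choice[i iP] S : exists i, E i = f S by have [i _ iE] := fE S I; exists i.
    by exists i => S S' e; apply: fI; rewrite ?inE// -!iP e.
  apply: card_le_trans (card_image_le _ _) _; apply/pcard_injP.
  by exists jI => ? ? _ _ /jI_inj.
- move=> _ [i _ <-] p; have [q [Vq Dq qp]] := dense i _ (QV p).
  have [_ _ cq] := canonP q Vq.
  by exists (toQ q Vq); [exists q|exact: le_tr qp].
- exists [set p | V p /\ exists2 q, G q & le (sval q) p]; split.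
  + by move=> p [].
  + move=> p q [Vp [p' Gp' pp']] [Vq [q' Gq' qq']].
    have [r [Gr rp rq]] := Gdir p' q' Gp' Gq'.
    exists (sval r); split; [|exact: le_tr pp'|exact: le_tr qq'].
    by split; [exact: QV|exists r].
  + move=> i; have [|p [[q [Vq Dq pq]] Gp]] := GE (E i); first by exists i.
    by exists q => //; split=> //; exists p.
Qed.

(** * Ultrafilters of positive sets *)

Definition coideal (T : Type) (Pos : set (set T)) : Prop :=
  [/\ Pos setT, ~ Pos set0, (forall A B, A `<=` B -> Pos A -> Pos B) &
      (forall A B, Pos (A `|` B) -> Pos A \/ Pos B)].

Definition meets (T : Type) (X : eqType) (B : X -> set T) (s : seq X) : set T :=
  [set t | forall x, x \in s -> B x t].

Lemma meets_cat (T : Type) (X : eqType) (B : X -> set T) (s s' : seq X) :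
  meets B (s ++ s') = meets B s `&` meets B s'.
Proof.
apply/seteqP; split=> [t h|t [h h'] x].
  by split=> x xs; apply: h; rewrite mem_cat xs ?orbT.
by rewrite mem_cat => /orP[]; [exact: h|exact: h'].
Qed.

Lemma meets_cons (T : Type) (X : eqType) (B : X -> set T) x (s : seq X) :
  meets B (x :: s) = B x `&` meets B s.
Proof.
apply/seteqP; split=> [t h|t [h h'] y].
  by split=> [|y ys]; apply: h; rewrite inE ?eqxx ?ys ?orbT.
by rewrite inE => /predU1P[->//|]; exact: h'.
Qed.

Lemma meets_nil (T : Type) (X : eqType) (B : X -> set T) :
  meets B [::] = setT.
Proof. by apply/seteqP; split. Qed.

(** The sets [B x] and the complements of non-positive sets generate a proper filter. *)
Lemma coideal_ultra (T : Type) (Pos : set (set T)) (X : eqType)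
    (B : X -> set T) :
  coideal Pos -> (forall s, Pos (meets B s)) ->
  exists u : set_system T, [/\ UltraFilter u, u `<=` Pos & forall x, u (B x)].
Proof.
move=> [posT pos0 posS posU] posB.
pose F : set_system T := [set A | exists s N, ~ Pos N /\ meets B s `\` N `<=` A].
have FF : ProperFilter F.
  split.
    move=> [s [N [nN sN]]]; apply: nN; apply: posS (posB s) => t st.
    by apply: contrapT => nNt; exact: sN (conj st nNt).
  split.
  - by exists [::], set0.
  - move=> A A' [s [N [nN sA]]] [s' [N' [nN' sA']]].
    exists (s ++ s'), (N `|` N'); split; first by move=> /posU[].
    rewrite meets_cat => t [[st st'] /not_orP[nt nt']].
    by split; [apply: sA|apply: sA'].
  - by move=> A A' AA' [s [N [nN sA]]]; exists s, N; split=> // t /sA/AA'.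
have [u [uU Fu]] := ultraFilterLemma FF.
exists u; split=> // [A uA|x].
  apply: contrapT => nA.
  have uA' : u (~` A) by apply: Fu; exists [::], A; split=> // t [].
  have : u (A `&` ~` A) by exact: filterI.
  by rewrite setICr => /filter_not_empty.
apply: Fu; exists [:: x], set0; split=> // t [+ _]; apply.
exact: mem_head.
Qed.

Lemma ultra_limit (T : Type) (u : set_system T) (F : T -> cantor_space) :
  UltraFilter u -> exists x, forall n, u (F @^-1` cylinder n x).
Proof.
move=> uU; exists (fun i => `[< u [set t | F t i] >]); elim=> [|n IHn].
  by apply: filterS filterT => t _ i.
have : u [set t | F t n = `[< u [set t | F t n] >]].
  case: asboolP => [|nu]; first exact.
  have [//|] := in_ultra_setVsetC [set t | F t n] uU.
  by apply: filterS => t /negP; rewrite /= => /negbTE ->.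
apply: filterS2 IHn => t h1 h2 i; rewrite ltnS leq_eqVlt => /predU1P[->//|].
exact: h1.
Qed.

(** One point serves all [n] and [s]: the limit of [F] along an ultrafilter of positive sets that
    contains [U] and every [B x]. *)
Lemma coideal_limit (T : Type) (Pos : set (set T)) (X : eqType)
    (B : X -> set T) (U : set T) (F : T -> cantor_space) :
  coideal Pos -> (forall s, Pos (meets B s `&` U)) ->
  exists x, forall n s, Pos (meets B s `&` U `&` F @^-1` cylinder n x).
Proof.
move=> Pc posB; have [_ _ posS _] := Pc.
pose B' (o : option X) := if o is Some x then B x else U.
have [s|u [uU uP uB]] := coideal_ultra (B := B') Pc.
  apply: posS (posB (pmap id s)) => t [st Ut] [x|] xs //=.
  by apply: st; rewrite mem_pmap map_id.
have [x ux] := ultra_limit F uU.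
exists x => n s; apply/uP/filterI => //.
apply: filterI; last exact: (uB None).
elim: s => [|y s IHs]; first by rewrite meets_nil; exact: filterT.
by rewrite meets_cons; apply: filterI => //; exact: (uB (Some y)).
Qed.

(** The reals code all maps [F]. At stage [k] the earlier stages form a small family, so the step
    applies to the map coded by [k]; finite intersections stay positive because a nonempty finite
    list of stages has a last one. *)
Lemma ultrafilter_construction (T : countType) (Pos : set (set T))
    (good : (T -> cantor_space) -> set (set T)) :
  coideal Pos ->
  (forall (X : choiceType) (B : X -> set T) F,
     small X -> embeds (seq X) (set nat) -> (forall s, Pos (meets B s)) ->
     exists S, good F S /\ forall s, Pos (meets B s `&` S)) ->
  exists u : set_system T,
    [/\ UltraFilter u, u `<=` Pos & forall F, exists2 S, u S & good F S].
Proof.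
move=> Pc step; have [posT pos0 posS posU] := Pc.
have [lt [[wf tr tot] sm]] := small_well_order.
pose dec (a : set nat) : T -> cantor_space :=
  fun t n => `[< a (pickle (t, n)) >].
have decP F : exists a, dec a = F.
  exists [set k | exists t n, k = pickle (t, n) /\ F t n].
  apply/funext => t; apply/funext => n; apply/asboolP/idP => [|h].
    by move=> [t' [n' [/(pcan_inj pickleK)[-> ->]]]].
  by exists t, n.
pose below k := {j : set nat | `[< lt j k >]}.
(* The default [set0] does not occur once the earlier intersections are positive ([stepA]). *)
pose next k (B : below k -> set T) : set T :=
  xget set0 [set S | good (dec k) S /\ forall s, Pos (meets B s `&` S)].
pose A : set nat -> set T := Fix wf (fun=> set T)
  (fun k rec => next k (fun j => rec (sval j) (asboolW (svalP j)))).
have AE k : A k = next k (fun j => A (sval j)).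
  by rewrite /A Fix_eq// => j f g fg; congr next; apply/funext => i; exact: fg.
have stepA k : (forall s : seq (below k), Pos (meets (fun j => A (sval j)) s)) ->
    good (dec k) (A k) /\
    forall s : seq (below k), Pos (meets (fun j => A (sval j)) s `&` A k).
  move=> /(step _ _ (dec k) (sm k)) H; rewrite AE /next; case: xgetP => //.
  move=> K; have [|S SP] := H; last by case: (K S).
  apply: embeds_trans embeds_seq_set; apply: embeds_seq.
  by exists sval; exact: val_inj.
have lift k (s : seq (set nat)) : (forall j, j \in s -> lt j k) ->
    exists s' : seq (below k), meets (fun j => A (sval j)) s' `<=` meets A s.
  move=> sk; exists (pmap insub s) => t h j js.
  have jk : `[< lt j k >] by apply/asboolP/sk.
  by have := h (exist _ j jk); apply; rewrite mem_pmap_sub.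
have posle k : forall s : seq (set nat), (forall j, j \in s -> lt j k \/ j = k) ->
    Pos (meets A s).
  elim: k / (wf k) => k _ IHk.
  have poslt s : (forall j, j \in s -> lt j k) -> Pos (meets A s).
    move=> sk; have [s0|[m ms mmax]] : s = [::] \/
      exists2 m, m \in s & forall j, j \in s -> lt j m \/ j = m.
      elim: s {sk} => [|i s IHs]; [by left|right].
      case: IHs => [->|[m ms mmax]].
        by exists i => [|j]; rewrite ?mem_seq1// => /eqP ->; right.
      have [im|[im|mi]] := tot i m.
      - exists m => [|j]; first by rewrite inE ms orbT.
        by rewrite inE => /predU1P[->|/mmax//]; left.
      - exists m => [|j]; first by rewrite inE ms orbT.
        by rewrite inE => /predU1P[->|/mmax//]; right.
      - exists i => [|j]; first exact: mem_head.
        rewrite inE => /predU1P[->|/mmax jm]; first by right.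
        by left; case: jm => [jm|->//]; exact: tr mi.
    - by rewrite s0 meets_nil.
    - by apply: (IHk m); first exact: sk.
  have [|_ posk] := stepA k.
    move=> s; have /posS : Pos (meets A (map sval s)).
      by apply: poslt => j /mapP[i _ ->]; exact/asboolP/(svalP i).
    by apply=> t h j js; exact/h/map_f.
  move=> s sk; have [|s' s'P] := lift k [seq j <- s | j != k].
    by move=> j; rewrite mem_filter => /andP[/eqP jk /sk[]].
  apply: posS (posk s') => t [ht kt] j js.
  have [->//|jk] := eqVneq j k.
  by apply: s'P => //; rewrite mem_filter jk.
have posA s : Pos (meets A s).
  have [m] : exists m, forall j, j \in s -> lt j m \/ j = m.
    elim: s => [|i s [m mmax]]; first by exists set0.
    have [im|[im|mi]] := tot i m.
    - by exists m => j; rewrite inE => /predU1P[->|/mmax//]; left.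
    - by exists m => j; rewrite inE => /predU1P[->|/mmax//]; right.
    - exists i => j; rewrite inE => /predU1P[->|/mmax jm]; first by right.
      by left; case: jm => [jm|->//]; exact: tr mi.
  exact: posle.
have [u [uU uP uA]] := coideal_ultra Pc posA.
exists u; split=> // F; have [k <-] := decP F; exists (A k) => //.
have [|//] := stepA k.
by move=> s; apply: posS (posA (map sval s)) => t h j js; exact/h/map_f.
Qed.

(** * Generic sets *)

Section forcing.
Variables (T Code : countType) (Pr : eqType).
Variables (U : Code -> set T) (okc : set Code) (okp : Code -> seq T -> set Pr).

(* A finite part of the generic set, a code for the region to which the *)
(* remaining elements are confined, and finitely many promises.         *)
Record condition := Condition
  { part : seq T; code : Code; promises : seq Pr }.

Definition valid : set condition := [set p | okc (code p) /\
  forall h, h \in promises p -> okp (code p) (part p) h].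

Definition extends (p q : condition) : Prop :=
  [/\ {subset part q <= part p}, U (code p) `<=` U (code q),
      {subset promises q <= promises p} &
      forall t, t \in part p -> t \in part q \/ U (code q) t].

Lemma extends_refl p : extends p p.
Proof. by split=> // t; left. Qed.

Lemma extends_trans p q r : extends p q -> extends q r -> extends p r.
Proof.
move=> [a1 c1 h1 u1] [a2 c2 h2 u2]; split.
- by move=> t /a2/a1.
- by move=> t /c1/c2.
- by move=> t /h2/h1.
- by move=> t /u1[/u2//|/c2]; right.
Qed.

(** The generic set is the union of the finite parts, and directedness makes each condition of [G]
    bind all of it. By König, a countable type times [seq X] still indexes too few dense sets to
    reach the continuum. *)
Lemma forcing (N : countType) (X : Type)
    (D : N -> seq X -> set condition) :
  MA_sigma_centered -> small X -> embeds (seq X) (set nat) ->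
  valid !=set0 ->
  (forall n s p, valid p -> exists q, [/\ valid q, D n s q & extends q p]) ->
  exists (G : set condition) (A : set T), [/\ G `<=` valid,
    (forall p q, G p -> G q ->
       exists r, [/\ G r, extends r p & extends r q]),
    (forall p, G p -> [set` part p] `<=` A /\
       forall t, A t -> t \in part p \/ U (code p) t) &
    forall n s, exists2 p, G p & D n s p].
Proof.
move=> MA sX eX V0 dense.
have [|||n p|G [GV Gdir GD]] := @MA_generic condition (N * seq X) valid extends
    (fun p => pickle (part p, code p)) (fun i => D i.1 i.2) MA V0
    extends_refl extends_trans.
- move=> [a1 c1 h1] [a2 c2 h2] [/= ok1 ok1'] [/= ok2 ok2'].
  move=> /(pcan_inj pickleK)[] e1 e2; subst a2 c2.
  exists (Condition a1 c1 (h1 ++ h2)); split=> //=.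
  + by split=> //= h; rewrite mem_cat => /orP[/ok1'|/ok2'].
  + by split=> //= [h hh1|]; [rewrite mem_cat hh1|left].
  + by split=> //= [h hh1|]; [rewrite mem_cat hh1 orbT|left].
- apply: embeds_trans embeds_seq_set; have [f fI] := eX.
  exists (fun i => [:: [set pickle i.1]; f i.2]) => -[n s] [m t] /= [+ /fI ->].
  move=> /seteqP[/(_ _ erefl)/= nm _].
  by rewrite (pcan_inj pickleK nm).
- move=> H; apply: sX; apply/embeds_nat_prod/(embeds_trans H).
  exact/embeds_pair/embeds_nat.
- by move=> Vp; exact: dense.
exists G, [set t | exists2 p, G p & t \in part p]; split=> //.
- move=> p Gp; split=> [t tp|t [q Gq tq]]; first by exists p.
  have [r [Gr [ap _ _ up] [aq _ _ _]]] := Gdir p q Gp Gq.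
  exact: up (aq _ tq).
- by move=> n s; exact: (GD (n, s)).
Qed.

End forcing.

(** * Convergence on unbounded sets *)

Lemma unbounded_coideal :
  coideal [set S : set nat | forall n, exists2 t, (n <= t)%N & S t].
Proof.
split=> /=.
- by move=> n; exists n.
- by move=> /(_ 0%N)[].
- by move=> A B AB + n => /(_ n)[t nt /AB]; exists t.
- move=> A B AB; apply: contrapT => /not_orP[].
  move=> /existsNP[n nA] /existsNP[m mB].
  have [t nmt [At|Bt]] := AB (maxn n m).
    by apply: nA; exists t => //; apply: leq_trans nmt; exact: leq_maxl.
  by apply: mB; exists t => //; apply: leq_trans nmt; exact: leq_maxr.
Qed.

(** The P-point is used only through this convergence. The regions are preimages of cylinders around
    the point of [coideal_limit]; each meets all finite intersections in unbounded sets, so points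
    can always be added. *)
Lemma convergent_ultrafilter : MA_sigma_centered ->
  exists u : set_system nat,
    [/\ UltraFilter u, (forall n, u [set t | (n <= t)%N]) &
        forall F : nat -> cantor_space, exists x, exists2 S, u S &
          forall n, exists m, forall t, (m <= t)%N -> S t -> cylinder n x (F t)].
Proof.
move=> MA.
pose good (F : nat -> cantor_space) : set (set nat) := [set S | exists x,
  forall n, exists m, forall t, (m <= t)%N -> S t -> cylinder n x (F t)].
have [|u [uU uP ugood]] := @ultrafilter_construction nat _ good unbounded_coideal.
  move=> X B F sX eX posB.
  have [|x xP] := coideal_limit (B := B) (U := setT) F unbounded_coideal.
    by move=> s; rewrite setIT.
  pose U d := F @^-1` cylinder d x.
  pose D (n : nat) (s : seq X) : set (condition nat nat unit) := [set p |
    (n <= code p)%N /\ exists t, [/\ (n <= t)%N, t \in part p & meets B s t]].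
  have [||G [A [GV Gdir GA GD]]] := @forcing nat nat unit U setT
      (fun _ _ => setT) nat X D MA sX eX.
  - by exists (Condition [::] 0%N [::]).
  - move=> n s [a d h] _.
    have [t nt [[Bt _] Ft]] := xP (maxn d n) s n.
    have sub : U (maxn d n) `<=` U d by move=> i; exact/cylinder_le/leq_maxl.
    exists (Condition (t :: a) (maxn d n) h); split=> //=.
      split=> /=; first exact: leq_maxr.
      by exists t; rewrite inE eqxx.
    split=> //= [i ia|i]; first by rewrite inE ia orbT.
    by rewrite inE => /predU1P[->|]; [right; exact: sub|left].
  exists A; split.
    exists x => n; have [p Gp [np _]] := GD n [::].
    have [_ Ap] := GA p Gp.
    exists (\max_(i <- part p) i).+1 => t mt /Ap[tp|]; last exact: cylinder_le.
    move: mt; rewrite ltnNge => /negP[].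
    exact: (@leq_bigmax_seq _ _ xpredT id).
  move=> s n; have [p Gp [_ [t [nt tp Bt]]]] := GD n s.
  by exists t => //; split=> //; apply: (GA p Gp).1.
exists u; split=> // [n|F].
  have [//|] := in_ultra_setVsetC [set t | (n <= t)%N] uU.
  by move=> /uP/(_ n)[t /= nt /(_ nt)].
by have [S uS [x xP]] := ugood F; exists x, S.
Qed.

(** * Scattered sets *)

Lemma cylinder_trans n (x y z : cantor_space) :
  cylinder n x y -> cylinder n y z -> cylinder n x z.
Proof. by move=> xy yz i ni; rewrite yz// xy. Qed.

Lemma cylinder_sym n (x y : cantor_space) : cylinder n x y -> cylinder n y x.
Proof. by move=> xy i ni; rewrite xy. Qed.

Lemma neq_cylinder (x y : cantor_space) :
  y <> x -> exists n, ~ cylinder n x y.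
Proof.
move=> yx; apply: contrapT => /forallNP H; apply: yx; apply/funext => i.
by have /contrapT := H i.+1; apply.
Qed.

Section crowded.
Variables (T : Type) (e : T -> cantor_space).

Definition crowded (Z : set T) : Prop := forall t, Z t -> forall n,
  exists t', [/\ Z t', e t' <> e t & cylinder n (e t) (e t')].

Definition unscattered (S : set T) : Prop :=
  exists Z : set T, [/\ Z `<=` S, Z !=set0 & crowded Z].

Lemma unscatteredS (A B : set T) :
  A `<=` B -> unscattered A -> unscattered B.
Proof. by move=> AB [Z [ZA ? ?]]; exists Z; split=> // t /ZA/AB. Qed.

Lemma crowded_cylinder (Z : set T) n y :
  crowded Z -> crowded (Z `&` e @^-1` cylinder n y).
Proof.
move=> cZ t [Zt ty] m; have [t' [Zt' t't tt']] := cZ t Zt (maxn n m).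
exists t'; split=> //; last exact: cylinder_le (leq_maxr _ _) _ tt'.
split=> //; apply: cylinder_trans ty _.
exact: cylinder_le (leq_maxl _ _) _ tt'.
Qed.

Lemma crowded_setD1 (Z : set T) y :
  crowded Z -> crowded (Z `&` [set t | e t <> y]).
Proof.
move=> cZ t [Zt ty] m; have [n nty] := neq_cylinder ty.
have [t' [Zt' t't tt']] := cZ t Zt (maxn n m).
exists t'; split=> //; last exact: cylinder_le (leq_maxr _ _) _ tt'.
split=> // e't; apply: nty; rewrite -e't; apply: cylinder_sym.
exact: cylinder_le (leq_maxl _ _) _ tt'.
Qed.

(** If the difference of [Z] and [A] is not crowded, then near some [t] all other points of [Z] lie
    in [A], and they form a crowded set. If it is crowded, it witnesses [B], or it is empty and [Z]
    witnesses [A]. *)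
Lemma unscatteredU (A B : set T) :
  unscattered (A `|` B) -> unscattered A \/ unscattered B.
Proof.
move=> [Z [ZAB [z Zz] cZ]]; apply: contrapT => /not_orP[nA nB].
have cZA : crowded (Z `\` A).
  move=> t [Zt nAt] n; apply: contrapT => /forallNP H; apply: nA.
  exists (Z `&` e @^-1` cylinder n (e t) `&` [set t' | e t' <> e t]); split.
  - move=> t' [[Zt' tt'] t't]; apply: contrapT => nAt'.
    by apply: (H t'); split.
  - by have [t' [? ? ?]] := cZ t Zt n; exists t'.
  - exact/crowded_setD1/crowded_cylinder.
apply: nB; exists (Z `\` A); split=> //; first by move=> t [/ZAB[]].
apply: contrapT => ZA0; apply: nA; exists Z; split=> //; last by exists z.
by move=> t Zt; apply: contrapT => nAt; apply: ZA0; exists t.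
Qed.

Lemma unscattered_point (S : set T) y : unscattered S ->
  exists t, [/\ S t, e t <> y &
    forall n, unscattered (S `&` e @^-1` cylinder n (e t))].
Proof.
move=> [Z [ZS [z Zz] cZ]].
have [t [Zt ty]] : exists t, Z t /\ e t <> y.
  have [zy|] := pselect (e z = y); last by exists z.
  by have [t [Zt tz _]] := cZ z Zz 0%N; exists t; split=> //; rewrite -zy.
exists t; split=> // [|n]; first exact: ZS.
exists (Z `&` e @^-1` cylinder n (e t)); split.
- by move=> i [/ZS].
- by exists t.
- exact: crowded_cylinder.
Qed.

Lemma unscattered_coideal : [set: T] !=set0 -> crowded setT ->
  coideal unscattered.
Proof.
move=> T0 cT; split.
- by exists setT.
- by move=> [Z [Z0 [t /Z0]]].
- exact: unscatteredS.
- exact: unscatteredU.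
Qed.

End crowded.

(** The promised points will form the crowded sets: all neighbourhoods of a promised point are
    positive within the region, so another point can be promised arbitrarily close to it. *)
Lemma null_ultrafilter (T : countType) (e : T -> cantor_space) :
  MA_sigma_centered -> [set: T] !=set0 -> crowded e setT ->
  exists u : set_system T,
    [/\ UltraFilter u, u `<=` unscattered e &
        forall F : T -> cantor_space, exists2 S, u S &
          forall k, exists (l : seq T) (L : seq (seq bool)) d,
            [/\ forall w, w \in L -> size w = d, (size L * 2 ^ k <= 2 ^ d)%N &
                forall t, S t -> t \in l \/ exists2 w, w \in L & cyl w (F t)]].
Proof.
move=> MA T0 cT; have Pc := unscattered_coideal T0 cT.
apply: (ultrafilter_construction (good := fun F => [set S | forall k,
  exists (l : seq T) (L : seq (seq bool)) d,
    [/\ forall w, w \in L -> size w = d, (size L * 2 ^ k <= 2 ^ d)%N &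
        forall t, S t -> t \in l \/ exists2 w, w \in L & cyl w (F t)]]) Pc).
move=> X B F sX eX posB.
pose U (D : seq (seq (seq bool))) : set T :=
  [set t | forall L, L \in D -> exists2 w, w \in L & cyl w (F t)].
pose okc D := forall s, unscattered e (meets B s `&` U D).
(* A promise [(s, q)]: the point [q] will be a limit of other points promised *)
(* for [s], hence of points of the generic set in [meets B s].                *)
pose okp D (a : seq T) (h : seq X * T) := [/\ h.2 \in a, meets B h.1 h.2 &
  forall n, unscattered e (meets B h.1 `&` U D `&` e @^-1` cylinder n (e h.2))].
pose ok := valid okc okp.
pose cond := condition T (seq (seq (seq bool))) (seq X * T)%type.
pose D (n : nat + option (T * nat)) (s : seq X) :
    set cond :=
  match n with
  | inl k => [set p : cond | exists2 L, L \in code p & exists d,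
      (forall w, w \in L -> size w = d) /\ (size L * 2 ^ k <= 2 ^ d)%N]
  | inr None => [set p : cond | exists q, (s, q) \in promises p]
  (* The first alternative keeps this set dense when [q] can no longer be promised for [s]. *)
  | inr (Some (q, n)) => [set p : cond |
      (forall r, ok r -> extends U r p -> (s, q) \notin promises r) \/
      exists q', [/\ (s, q') \in promises p, e q' <> e q &
                     cylinder n (e q) (e q')]]
  end.
have [||G [A [GV Gdir GA GD]]] := @forcing _ _ _ U okc okp _ X D MA sX eX.
- exists (Condition [::] [::] [::]); split=> // s /=.
  by apply: unscatteredS (posB s) => t st; split.
- have okpS c a a' h : {subset a <= a'} -> okp c a h -> okp c a' h.
    by move=> aa' [ha hB hU]; split=> //; exact: aa'.
  move=> [k|[[q n]|]] s [a c h] [okc0 okp0] /=.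
  + have [x xP] := coideal_limit F Pc okc0.
    (* Around [y g] the values of [F] can be confined without breaking the promise [g]; [x] does the
       same for the finite intersections. *)
    have /choice[y yP] (g : seq X * T) : exists y, g \in h -> forall n d,
        unscattered e (meets B g.1 `&` U c `&` e @^-1` cylinder n (e g.2) `&`
          F @^-1` cylinder d y).
      have [gh|] := boolP (g \in h); last by exists point.
      have [_ _ gU] := okp0 g gh.
      have [|y yP] := coideal_limit (B := fun n => e @^-1` cylinder n (e g.2))
          (U := meets B g.1 `&` U c) F Pc.
        move=> s'; apply: unscatteredS (gU (\max_(i <- s') i)%N).
        move=> t [st et]; split=> // n' ns'; apply: cylinder_le et.
        exact: (@leq_bigmax_seq _ _ xpredT id).
      exists y => _ n d; apply: unscatteredS (yP d [:: n]).
      move=> t [[/(_ n (mem_head _ _)) et [st ct]] Ft].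
      by split.
    (* [L] has [1 + size h] words, and [1 + size h] is at most [2 ^ size h]. *)
    pose d := (k + size h)%N.
    pose L := mkseq x d :: [seq mkseq (y g) d | g <- h].
    have Lx t : cylinder d x (F t) -> exists2 w, w \in L & cyl w (F t).
      by rewrite cylE => xt; exists (mkseq x d) => //; exact: mem_head.
    have Ly g t : g \in h -> cylinder d (y g) (F t) ->
        exists2 w, w \in L & cyl w (F t).
      move=> gh; rewrite cylE => yt; exists (mkseq (y g) d) => //.
      by rewrite inE (map_f (fun g => mkseq (y g) d)) ?orbT.
    have UL t : (exists2 w, w \in L & cyl w (F t)) -> U c t -> U (L :: c) t.
      by move=> Lt ct M; rewrite inE => /predU1P[->//|/ct].
    exists (Condition a (L :: c) h); split.
    * split=> /= [s'|g gh].
        apply: unscatteredS (xP d s') => t [[st ct] /Lx xt].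
        by split=> //; exact: UL.
      have [ga gB _] := okp0 g gh; split=> // n.
      apply: unscatteredS (yP g gh n d) => t [[[st ct] et] /(Ly _ _ gh) yt].
      by split=> //; split=> //; exact: UL.
    * exists L; first exact: mem_head.
      exists d; split=> [w|].
        by rewrite inE => /predU1P[->|/mapP[g _ ->]]; rewrite size_mkseq.
      by rewrite /= size_map /d expnD mulnC leq_mul2l ltn_expl ?orbT.
    * split=> //= [t ct M Mc|t ta]; first by apply: ct; rewrite inE Mc orbT.
      by left.
  + have [[[a' c' h'] [[okc1 okp1] [aa' cc' hh' ua']] /= sq]|nH] :=
      pselect (exists2 r, ok r /\ extends U r (Condition a c h) &
        (s, q) \in promises r).
      have [_ _ /(_ n)/(unscattered_point (e q))] := okp1 _ sq.
      move=> [q' [[[/= q'B q'U] qq'] q'q q'P]].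
      exists (Condition (q' :: a') c' ((s, q') :: h')); split.
      * split=> //= g; rewrite inE => /predU1P[->|/okp1]; last first.
          by apply: okpS => t ta; rewrite inE ta orbT.
        split=> //=; first exact: mem_head.
        by move=> m; apply: unscatteredS (q'P m) => t [[]].
      * by right; exists q'; split=> //=; exact: mem_head.
      * split=> //= [t ta|g gh|t].
        - by rewrite inE (aa' t ta) orbT.
        - by rewrite inE (hh' g gh) orbT.
        - by rewrite inE => /predU1P[->|/ua'//]; right; exact: cc'.
    exists (Condition a c h); split; [by []| |exact: extends_refl].
    by left=> r okr rp; apply/negP => sq; apply: nH; exists r.
  + have [t0 [[qB qU] _ qP]] := unscattered_point point (okc0 s).
    exists (Condition (t0 :: a) c ((s, t0) :: h)); split.
    * split=> //= g; rewrite inE => /predU1P[->|/okp0]; last first.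
        by apply: okpS => t ta; rewrite inE ta orbT.
      by split=> //=; exact: mem_head.
    * by exists t0; exact: mem_head.
    * split=> //= [t ta|g gh|t].
      - by rewrite inE ta orbT.
      - by rewrite inE gh orbT.
      - by rewrite inE => /predU1P[->|]; [right|left].
exists A; split=> [k|s].
  have [p Gp [L Lp [d [Ld Lk]]]] := GD (inl k) [::].
  exists (part p), L, d; split=> // t /(GA p Gp).2[|pt]; first by left.
  by right; exact: pt.
exists [set q | exists2 p, G p & (s, q) \in promises p]; split.
- move=> q [p Gp sq]; have [_ okp0] := GV p Gp; have [qa qB _] := okp0 _ sq.
  by split=> //; exact: (GA p Gp).1.
- by have [p Gp [q sq]] := GD (inr None) s; exists q, p.
- move=> q [p Gp sq] n; have [r Gr] := GD (inr (Some (q, n))) s.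
  have [w [Gw wp wr]] := Gdir p r Gp Gr.
  case=> [/(_ w (GV _ Gw) wr)/negP[]|[q' [sq' q'q qq']]].
    by have [_ _ sub _] := wp; exact: sub.
  by exists q'; split=> //; exists r.
Qed.

(** * Sets of positive upper density *)

Lemma cyl_cat (c w : seq bool) (y : cantor_space) : cyl (c ++ w) y <->
  cyl c y /\ forall i, (i < size w)%N -> y (size c + i)%N = nth false w i.
Proof.
rewrite /cyl /cylinder /= size_cat; split=> [h|[h1 h2] i].
  split=> i ic; rewrite h ?nth_cat ?ic//; first exact: ltn_addr.
    by rewrite ltnNge leq_addr /= addKn.
  by rewrite ltn_add2l.
move=> isz; rewrite nth_cat; case: (ltnP i (size c)) => [|ci]; first exact: h1.
by rewrite -{1}(subnKC ci) h2// ltn_subLR.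
Qed.

(** These words form an infinite antichain below [c], which supplies the disjoint pieces for
    [limsup_gt_setD]. *)
Definition comb (c : seq bool) (j : nat) : seq bool :=
  c ++ rcons (nseq j false) true.

Lemma comb_disjoint c i j y : i <> j -> cyl (comb c i) y -> ~ cyl (comb c j) y.
Proof.
wlog ij : i j / (i < j)%N.
  move=> H nij yi yj; have [ij|ji|//] := ltngtP i j; first exact: (H i j).
  by apply: (H j i) => // /esym.
move=> _ /cyl_cat[_ yi] /cyl_cat[_ yj].
have := yi i; have := yj i; rewrite !size_rcons !size_nseq !nth_rcons !size_nseq.
rewrite ltnn eqxx ij nth_nseq ij => -> //; last exact: ltnW.
by move=> /(_ (ltnSn _)).
Qed.

Section density.
Local Open Scope ring_scope.
Variables (R : realType) (T : countType) (d : nat -> set T -> R).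
Hypothesis d0 : forall n, d n set0 = 0.
Hypothesis dT : forall n, d n setT = 1.
Hypothesis dS : forall n A B, A `<=` B -> d n A <= d n B.
Hypothesis dU : forall n A B, A `&` B = set0 -> d n (A `|` B) = d n A + d n B.
Hypothesis d_fin : forall n, exists l : seq T, forall A,
  d n (A `&` [set` l]) = d n A.

Lemma density_setD n (A B : set T) : d n A = d n (A `\` B) + d n (A `&` B).
Proof.
rewrite -dU; first by rewrite setUC setUIDK.
by apply/seteqP; split=> // t [[_ +] [_]].
Qed.

Definition limsup_gt (r : R) (A : set T) : Prop :=
  exists2 r', r < r' & forall m, exists2 n, (m <= n)%N & r' <= d n A.

(** Thresholds [1 / (N + 1)] let a countable type index the dense sets of the forcing. *)
Definition dense_positive (A : set T) : Prop :=
  exists N : nat, limsup_gt (N.+1%:R^-1) A.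

Lemma limsup_gtS r (A B : set T) : A `<=` B -> limsup_gt r A -> limsup_gt r B.
Proof.
move=> AB [r' rr' H]; exists r' => // m; have [n mn h] := H m.
by exists n => //; exact: le_trans h (dS _ AB).
Qed.

Lemma dense_positiveE (A : set T) :
  dense_positive A <-> limsup_gt 0 A.
Proof.
split=> [[N [r Nr H]]|[r r0 H]].
  by exists r => //; apply: le_lt_trans Nr; rewrite invr_ge0.
have [N _ NP] := near_infty_natSinv_lt (PosNum r0).
by exists N, r => //; exact: NP (leqnn N).
Qed.

Lemma dense_positive_coideal : coideal dense_positive.
Proof.
split.
- apply/dense_positiveE; exists 1 => // m; exists m => //; by rewrite dT.
- move=> /dense_positiveE[r r0 /(_ 0%N)[n _]]; rewrite d0; lra.
- by move=> A B AB /dense_positiveE/(limsup_gtS AB)/dense_positiveE.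
- move=> A B /dense_positiveE[r r0 H]; apply: contrapT => /not_orP[nA nB].
  have K (C : set T) : ~ dense_positive C ->
      exists m, forall n, (m <= n)%N -> d n C < r / 2.
    move=> nC; apply: contrapT => /forallNP K; apply/nC/dense_positiveE.
    exists (r / 2); first lra.
    move=> m; have /existsNP[n /not_implyP[mn /negP]] := K m.
    by rewrite -leNgt => h; exists n.
  have [m mA] := K _ nA; have [m' mB] := K _ nB.
  have [n + ] := H (maxn m m'); rewrite geq_max => /andP[mn mn'].
  rewrite (density_setD n (A `|` B) A).
  have h1 : d n ((A `|` B) `\` A) <= d n B by apply: dS => t [[]].
  have h2 : d n ((A `|` B) `&` A) <= d n A by apply: dS => t [].
  by have := mA n mn; have := mB n mn'; lra.
Qed.

(* If removing any one of many disjoint pieces lowered the limit superior *)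
(* below [r], these pieces together would have density more than [1].      *)
Lemma limsup_gt_setD r (A : set T) (S : nat -> set T) :
  (forall i j, i <> j -> S i `&` S j = set0) -> limsup_gt r A ->
  exists m, forall j, (m <= j)%N -> limsup_gt r (A `\` S j).
Proof.
move=> dis [r' rr' H].
(* At levels where [A] has density at least [r'] but less than [r + g] without [S j], the part of
   [A] in [S j] has density above [r' - r - g = g]. *)
pose g := (r' - r) / 2; have g0 : 0 < g by rewrite /g; lra.
apply: contrapT => /forallNP nm.
have /choice[b bP] m : exists j, (m <= j)%N /\ ~ limsup_gt r (A `\` S j).
  by have /existsNP[j /not_implyP] := nm m; exists j.
have small j : ~ limsup_gt r (A `\` S j) ->
    exists m, forall n, (m <= n)%N -> d n (A `\` S j) < r + g.
  move=> nl; apply: contrapT => /forallNP K; apply: nl.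
  exists (r + g); first lra.
  move=> m; have /existsNP[n /not_implyP[mn /negP]] := K m.
  by rewrite -leNgt => h; exists n.
have pieces k : exists (M : nat) (P : set T) m,
    (forall j, (M <= j)%N -> P `&` S j = set0) /\
    (forall n, (m <= n)%N -> r' <= d n A -> k%:R * g <= d n P).
  elim: k => [|k [M [P [m [PM Pm]]]]].
    exists 0%N, set0, 0%N; split=> // [j _|n _ _]; first by rewrite set0I.
    by rewrite mul0r d0.
  have [Mb nb] := bP M; have [m' m'P] := small _ nb.
  exists (b M).+1, (P `|` (A `&` S (b M))), (maxn m m'); split=> // [j bj|n].
    rewrite setIUl PM ?set0U; last exact: leq_trans Mb (ltnW bj).
    by rewrite -setIA dis ?setI0//; apply/eqP; rewrite ltn_eqF.
  rewrite geq_max => /andP[mn mn'] An.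
  rewrite dU; last by rewrite setICA PM// setI0.
  have := m'P n mn'; have := Pm n mn An; have := density_setD n A (S (b M)).
  by rewrite -natr1 mulrDl mul1r; rewrite /g in g0 *; lra.
have [N _ NP] := near_infty_natSinv_lt (PosNum g0).
have [M [P [m [_ Pm]]]] := pieces N.+1.
have [n mn An] := H m; have := Pm n mn An.
have := dS n (@subsetT _ P); rewrite dT => P1 P2.
have := NP N (leqnn N).
by rewrite /= -div1r ltr_pdivrMr ?ltr0n// mulrC; lra.
Qed.

(** For each [c] some [comb c j] is forbidden. All promises survive this for large [j]; the finite
    intersections stay positive if the cylinder misses the point of [coideal_limit], which rules out
    at most one [j]. *)
Lemma nwd_ultrafilter : MA_sigma_centered ->
  exists u : set_system T,
    [/\ UltraFilter u, u `<=` dense_positive &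
        forall F : T -> cantor_space, exists2 S, u S &
          forall c, exists (l : seq T) w,
            forall t, S t -> t \in l \/ ~ cyl (c ++ w) (F t)].
Proof.
move=> MA; have Pc := dense_positive_coideal.
apply: (ultrafilter_construction (good := fun F => [set S | forall c,
  exists (l : seq T) w, forall t, S t -> t \in l \/ ~ cyl (c ++ w) (F t)]) Pc).
move=> X B F sX eX posB.
pose U (D : seq (seq bool)) : set T :=
  [set t | forall w, w \in D -> ~ cyl w (F t)].
pose okc D := forall s, dense_positive (meets B s `&` U D).
(* A promise [(s, N)]: the generic set will have density at least [1 / (N + 1)] *)
(* inside [meets B s] at infinitely many levels.                               *)
pose okp D (a : seq T) (h : seq X * nat) :=
  limsup_gt (h.2.+1%:R^-1) (meets B h.1 `&` U D).
pose ok := valid okc okp.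
pose cond := condition T (seq (seq bool)) (seq X * nat)%type.
pose D (n : seq bool + option (nat * nat)) (s : seq X) : set cond :=
  match n with
  | inl c => [set p : cond | exists w, c ++ w \in code p]
  | inr None => [set p : cond | exists N, (s, N) \in promises p]
  | inr (Some (N, m)) => [set p : cond |
      (forall r, ok r -> extends U r p -> (s, N) \notin promises r) \/
      exists2 n, (m <= n)%N & N.+1%:R^-1 <= d n (meets B s `&` [set` part p])]
  end.
have [||G [A [GV Gdir GA GD]]] := @forcing _ _ _ U okc okp _ X D MA sX eX.
- exists (Condition [::] [::] [::]); split=> // s /=.
  case: (posB s) => N h; exists N; apply: limsup_gtS h => t st; split=> //.
- move=> [c|[[N m]|]] s [a D0 h] [/= okc0 okp0] /=.
  + have [x xP] := coideal_limit F Pc okc0.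
    have [M hM] : exists M, forall j g, (M <= j)%N -> g \in h ->
        limsup_gt (g.2.+1%:R^-1)
          ((meets B g.1 `&` U D0) `\` F @^-1` cyl (comb c j)).
      elim: h okp0 => [|g h IHh] okp0; first by exists 0%N.
      have [|M hM] := IHh; first by move=> g' gh; apply: okp0; rewrite inE gh orbT.
      have [|M' gM'] := limsup_gt_setD (S := fun j => F @^-1` cyl (comb c j)) _
        (okp0 _ (mem_head _ _)).
        move=> i j ij; apply/seteqP; split=> // t [] /comb_disjoint.
        by move=> /(_ j ij).
      exists (maxn M M') => j g'; rewrite geq_max inE => /andP[Mj M'j].
      by move=> /predU1P[->|]; [exact: gM'|exact: hM].
    have [j Mj xj] : exists2 j, (M <= j)%N & ~ cyl (comb c j) x.
      have [xM|] := pselect (cyl (comb c M) x); last by exists M.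
      exists M.+1 => //; apply: comb_disjoint xM.
      by apply/eqP; rewrite ltn_eqF.
    have UD t : U D0 t -> ~ cyl (comb c j) (F t) -> U (comb c j :: D0) t.
      by move=> h0 h1 w; rewrite inE => /predU1P[->//|/h0].
    exists (Condition a (comb c j :: D0) h); split.
    * split=> /= [s'|g gh].
        have [N hN] := xP (size (comb c j)) s'; exists N; apply: limsup_gtS hN.
        move=> t [[st ct] xt]; split=> //; apply: UD => // tj; apply: xj.
        by move=> i ij; rewrite -(xt i ij); exact: tj.
      by apply: limsup_gtS (hM j g Mj gh) => t [[st ct] tj]; split=> //; exact: UD.
    * by exists (rcons (nseq j false) true); exact: mem_head.
    * split=> //= [t ct w wD|t ta]; first by apply: ct; rewrite inE wD orbT.
      by left.
  + have [[[a' D' h'] [[okc1 okp1] [aa' cc' hh' ua']] /= sN]|nH] :=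
      pselect (exists2 r, ok r /\ extends U r (Condition a D0 h) &
        (s, N) \in promises r).
      have [r Nr /(_ m)[n mn dn]] := okp1 _ sN.
      (* A finite list carries all of [d n], so adding its allowed points achieves the density at
         once. *)
      have [l lP] := d_fin n.
      exists (Condition ([seq t <- l | `[< (meets B s `&` U D') t >]] ++ a') D' h').
      split.
      * by split=> //= g /okp1.
      * right; exists n => //; apply: le_trans (ltW Nr) _; apply: le_trans dn _.
        rewrite -lP; apply: dS => t [[st ct] lt]; split=> //=.
        by rewrite mem_cat mem_filter lt andbT; apply/orP; left; apply/asboolP.
      * split=> //= [t ta|t]; first by rewrite mem_cat (aa' t ta) orbT.
        rewrite mem_cat mem_filter => /orP[/andP[/asboolP[_ ct] _]|/ua'//].
        by right; exact: cc'.
    exists (Condition a D0 h); split; [by []| |exact: extends_refl].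
    by left=> r okr rp; apply/negP => sN; apply: nH; exists r.
  + have [N hN] := okc0 s.
    exists (Condition a D0 ((s, N) :: h)); split.
    * by split=> //= g; rewrite inE => /predU1P[->|/okp0].
    * by exists N; exact: mem_head.
    * by split=> //= [g gh|t]; [rewrite inE gh orbT|left].
exists A; split=> [c|s].
  have [p Gp [w wp]] := GD (inl c) [::].
  exists (part p), w => t /(GA p Gp).2[|pt]; first by left.
  by right; exact: pt.
(* The generic set is only known to reach [1 / (N + 1)], while positivity is strict; hence the
   threshold [1 / (N + 2)]. *)
have [p Gp [N sN]] := GD (inr None) s; exists N.+1.
exists (N.+1%:R^-1) => [|m].
  by rewrite ltf_pV2 ?posrE ?ltr0n// ltr_nat.
have [r Gr] := GD (inr (Some (N, m))) s.
have [w [Gw wp wr]] := Gdir p r Gp Gr.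
case=> [/(_ w (GV _ Gw) wr)/negP[]|[n mn dn]].
  by have [_ _ sub _] := wp; exact: sub.
exists n => //; apply: le_trans dn _; apply: dS => t [st tr]; split=> //.
exact: (GA r Gr).1.
Qed.

End density.

(** * Limits of ultrafilters along a P-point *)

Lemma isolatedP (Y : set cantor_space) y : isolated Y y <->
  Y y /\ exists n, forall z, Y z -> cylinder n y z -> z = y.
Proof.
split=> [[/set_mem Yy [V /nbhs_cylinder[n nV] VY]]|[Yy [n nY]]].
  split=> //; exists n => z Yz /nV Vz.
  by have : [set y] z by rewrite -VY.
split; first exact/mem_set.
exists (cylinder n y).
  by apply: open_nbhs_nbhs; split; [exact: open_cylinder|].
by apply/seteqP; split=> [z [yz Yz]|z ->]; [exact: nY|split].
Qed.

Lemma closure_cylinder (Y : set cantor_space) z : closure Y z <->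
  forall n, exists2 y, Y y & cylinder n z y.
Proof.
split=> [cz n|H U /nbhs_cylinder[n nU]].
  have [|y [Yy zy]] := cz (cylinder n z); last by exists y.
  by apply: open_nbhs_nbhs; split; [exact: open_cylinder|].
by have [y Yy zy] := H n; exists y; split=> //; exact: nU.
Qed.

Lemma open_cylinders (U : set cantor_space) :
  (forall y, U y -> exists n, cylinder n y `<=` U) -> open U.
Proof.
move=> H; rewrite openE => y /H[n nU]; apply: filterS nU _.
by apply: open_nbhs_nbhs; split; [exact: open_cylinder|].
Qed.

Lemma discrete_setS (A B : set cantor_space) :
  A `<=` B -> discrete_set B -> discrete_set A.
Proof.
move=> AB dB y Ay; have /isolatedP[_ [n nB]] := dB y (AB y Ay).
by apply/isolatedP; split=> //; exists n => z /AB; exact: nB.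
Qed.

Lemma scattered_setS (A B : set cantor_space) :
  A `<=` B -> scattered_set B -> scattered_set A.
Proof. by move=> AB sB Z ZA; apply: sB => z /ZA/AB. Qed.

Lemma measure_zero_setS (R : realType) (A B : set cantor_space) :
  A `<=` B -> measure_zero_set R B -> measure_zero_set R A.
Proof.
move=> AB B0; apply/eqP; rewrite eq_le measure_ge0 andbT -B0.
have mc (C : set cantor_space) : measurable (closure C : set cantor_borel).
  rewrite -[closure C]setCK; apply: measurableC; apply: sub_sigma_algebra.
  exact/closed_openC/closed_closure.
by apply: le_measure; rewrite ?inE//; exact: closure_subset.
Qed.

Lemma finite_separate (A : set cantor_space) y : finite_set A ->
  exists n, forall z, A z -> cylinder n y z -> z = y.
Proof.
move=> /finite_seqP[l ->]; elim: l => [|a l [m nm]]; first by exists 0%N.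
have [ay|/neq_cylinder[k nk]] := pselect (a = y).
  by exists m => z /=; rewrite inE => /predU1P[->//|]; exact: nm.
exists (maxn k m) => z /=; rewrite inE => /predU1P[->|zl] yz.
  by case: nk; exact: cylinder_le (leq_maxl _ _) _ yz.
by apply: nm => //; exact: cylinder_le (leq_maxr _ _) _ yz.
Qed.

Lemma discrete_set_finite (Y : set cantor_space) :
  (forall y, Y y -> exists n, finite_set (Y `&` cylinder n y)) ->
  discrete_set Y.
Proof.
move=> H y Yy; apply/isolatedP; split=> //.
have [n /(finite_separate y)[m nm]] := H y Yy.
exists (maxn n m) => z Yz yz; apply: nm.
  by split=> //; exact: cylinder_le (leq_maxl _ _) _ yz.
exact: cylinder_le (leq_maxr _ _) _ yz.
Qed.

Lemma scattered_setP (Y : set cantor_space) :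
  scattered_set Y <-> ~ unscattered id Y.
Proof.
split=> [sY [Z [ZY Z0 cZ]]|nY Z ZY Z0].
  have [z /isolatedP[Zz [n nZ]]] := sY Z ZY Z0.
  by have [z' [Zz' z'z /nZ-/(_ Zz')]] := cZ z Zz n.
apply: contrapT => nZ; apply: nY; exists Z; split=> // z Zz n.
apply: contrapT => /forallNP H; apply: nZ; exists z; apply/isolatedP.
split=> //; exists n => z' Zz' zz'; apply: contrapT => z'z.
exact: (H z').
Qed.

Lemma unscattered_image (T : Type) (e : T -> cantor_space) (S : set T) :
  unscattered e S -> ~ scattered_set (e @` S).
Proof.
move=> [Z [ZS [z Zz] cZ]] /scattered_setP; apply.
exists (e @` Z); split; first exact: image_subset.
  by exists (e z), z.
move=> _ [t Zt <-] n; have [t' [Zt' t't tt']] := cZ t Zt n.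
by exists (e t'); split=> //; exists t'.
Qed.

Lemma scattered_set0 : scattered_set set0.
Proof. by move=> Z Z0 [z /Z0]. Qed.

Lemma scattered_setU (A B : set cantor_space) :
  scattered_set A -> scattered_set B -> scattered_set (A `|` B).
Proof. by rewrite !scattered_setP => nA nB /unscatteredU[]. Qed.

Lemma scattered_bigcup n (Y : nat -> set cantor_space) :
  (forall i, scattered_set (Y i)) ->
  scattered_set [set z | exists2 i, (i < n)%N & Y i z].
Proof.
move=> sY; elim: n => [|n IHn].
  by apply: scattered_setS scattered_set0 => z [].
apply: scattered_setS (scattered_setU IHn (sY n)) => z [i].
by rewrite ltnS leq_eqVlt => /predU1P[->|ni] ?; [right|left; exists i].
Qed.

(** Some point of [Z] lies off a cylinder around [x]; as cylinders are clopen, a point isolated in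
    the rest of [Z] is isolated in [Z]. *)
Lemma scattered_locally (Y : set cantor_space) x : ~ Y x ->
  (forall n, scattered_set (Y `\` cylinder n x)) -> scattered_set Y.
Proof.
move=> nYx sY Z ZY [z Zz].
have [|n xz] := @neq_cylinder x z.
  by move=> zx; apply: nYx; rewrite -zx; exact: ZY.
have [||y /isolatedP[[Zy xy] [m my]]] := sY n (Z `\` cylinder n x).
- by move=> t [/ZY].
- by exists z.
exists y; apply/isolatedP; split=> //; exists (maxn n m) => t Zt yt.
apply: my; last exact: cylinder_le (leq_maxr _ _) _ yt.
split=> // xt; apply: xy; apply: cylinder_trans xt _; apply: cylinder_sym.
exact: cylinder_le (leq_maxl _ _) _ yt.
Qed.

Lemma ultraP (T : Type) (u : set_system T) : Filter u -> ~ u set0 ->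
  (forall A, u A \/ u (~` A)) -> UltraFilter u.
Proof.
move=> uF u0 uV; split; first by split.
move=> G GF uG; apply/seteqP; split=> // A GA.
have [//|uA] := uV A.
have : G (A `&` ~` A) by apply: filterI => //; exact: uG.
by rewrite setICr => /filter_not_empty.
Qed.

Definition ultra_map (S T : Type) (f : S -> T) (u : set_system S) :
  set_system T := [set A | u (f @^-1` A)].

Lemma ultra_map_ultra (S T : Type) (f : S -> T) (u : set_system S) :
  UltraFilter u -> UltraFilter (ultra_map f u).
Proof.
move=> uU; apply: ultraP => [|A]; last exact: (in_ultra_setVsetC (f @^-1` A)).
by rewrite /ultra_map /= preimage_set0 => /filter_not_empty.
Qed.

Definition ultra_lim (T : Type) (u : set_system nat)
  (v : nat -> set_system T) : set_system T := [set A | u [set k | v k A]].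

Lemma ultra_lim_ultra (T : Type) (u : set_system nat)
    (v : nat -> set_system T) :
  UltraFilter u -> (forall k, UltraFilter (v k)) -> UltraFilter (ultra_lim u v).
Proof.
move=> uU vU; apply: ultraP => [||A].
- split; rewrite /ultra_lim /=.
  + by apply: filterS filterT => k _; exact: filterT.
  + by move=> A B /=; apply: filterS2 => k; exact: filterI.
  + by move=> A B AB /=; apply: filterS => k; exact: filterS.
- by rewrite /ultra_lim /= => /filter_ex[k]; exact: filter_not_empty.
- have [|h] := in_ultra_setVsetC [set k | v k A] uU; first by left.
  right; apply: filterS h => k nA.
  by have [] := in_ultra_setVsetC A (vU k).
Qed.

Section convergent.
Variable u : set_system nat.
Hypothesis uU : UltraFilter u.
Hypothesis uinf : forall n, u [set t | (n <= t)%N].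
Hypothesis ulim : forall F : nat -> cantor_space, exists x, exists2 S, u S &
  forall n, exists m, forall t, (m <= t)%N -> S t -> cylinder n x (F t).

Definition scattering (T : Type) (v : set_system T) : Prop :=
  forall F : T -> cantor_space, exists2 S, v S & scattered_set (F @` S).

Lemma scattering_map (S T : Type) (f : S -> T) v : UltraFilter v ->
  scattering v -> scattering (ultra_map f v).
Proof.
move=> vU vs F; have [A vA sA] := vs (F \o f).
exists (f @` A); last by rewrite image_comp.
by rewrite /ultra_map /=; apply: filterS vA => t At; exists t.
Qed.

Lemma scattered_set1 x : scattered_set [set x].
Proof.
apply/scattered_setP => -[Z [Zx [z Zz] cZ]].
by have [z' [/Zx/= -> + _]] := cZ z Zz 0%N; rewrite (Zx z Zz).
Qed.

(** The limits [x k] of [F] along [v k] converge to some [x0]. Unless [F] is [x0] on a large set,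
    confine the [k]-th piece to [cylinder k (x k)] and remove the value [x0]: away from [x0] only
    finitely many scattered pieces remain. *)
Lemma scattering_lim (T : Type) (v : nat -> set_system T) :
  (forall k, UltraFilter (v k)) -> (forall k, scattering (v k)) ->
  scattering (ultra_lim u v).
Proof.
move=> vU vs F.
have /choice[A AP] k : exists A, v k A /\ scattered_set (F @` A).
  by have [A] := vs k F; exists A.
have /choice[x xP] k : exists x, forall n, v k (F @^-1` cylinder n x).
  exact: ultra_limit.
have [x0 [B uB BP]] := ulim x.
have [ueq|uneq] := in_ultra_setVsetC [set k | v k (F @^-1` [set x0])] uU.
  exists (F @^-1` [set x0]) => //.
  by apply: scattered_setS (@scattered_set1 x0) => _ [t tx <-].
exists [set t | exists k,
  [/\ B k, A k t, cylinder k (x k) (F t) & F t <> x0]].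
  apply: filterS2 uB uneq => k Bk nk.
  have nk' : v k (F @^-1` (~` [set x0])).
    by have [] := in_ultra_setVsetC (F @^-1` [set x0]) (vU k).
  have := xP k k; have := (AP k).1; move: nk'.
  by apply: filterS3 => t xt At kt; exists k.
apply: (@scattered_locally _ x0) => [[t [k [_ _ _ tx]]]//|n].
have [m mP] := BP n.
apply: scattered_setS (@scattered_bigcup (maxn n m) _ (fun i => (AP i).2)).
move=> _ [[t [k [Bk At kt tx]] <-] nt]; exists k; last by exists t.
rewrite ltnNge; apply/negP; rewrite geq_max => /andP[nk mk]; apply: nt.
by apply: cylinder_trans (mP k mk Bk) _; exact: cylinder_le nk _ kt.
Qed.

(** * Powers of the P-point *)

Fixpoint upow (n : nat) : set_system (seq nat) :=
  if n is m.+1 then ultra_lim u (fun k => ultra_map (cons k) (upow m))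
  else [set A | A [::]].

Lemma upow_ultra n : UltraFilter (upow n).
Proof.
elim: n => [|n IHn] /=.
  apply: ultraP => [|//|A]; last exact: EM.
  by split=> // A B AB; exact: AB.
by apply: ultra_lim_ultra => k; exact: ultra_map_ultra.
Qed.

Lemma upow_scattering n : scattering (upow n).
Proof.
elim: n => [|n IHn] /=.
  move=> F; exists [set [::]] => //.
  by rewrite image_set1; exact: scattered_set1.
have := upow_ultra n => ?.
by apply: scattering_lim => k; [exact: ultra_map_ultra|exact: scattering_map].
Qed.

Lemma upow_cat n m (A : set (seq nat)) :
  upow (n + m) A = upow n [set s | upow m [set t | A (s ++ t)]].
Proof.
elim: n A => [//|n IHn] A; rewrite addSn /=; congr u.
by apply/funext => k; exact: IHn.
Qed.

(** Padded with zeros, the code of [s ++ k :: t] converges to that of [s] as [k] grows. *)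
Fixpoint unary (s : seq nat) : seq bool :=
  if s is k :: s' then nseq k false ++ true :: unary s' else [::].

Definition unary_point (s : seq nat) : cantor_space := nth false (unary s).

Lemma unary_cat s t : unary (s ++ t) = unary s ++ unary t.
Proof. by elim: s => //= k s ->; rewrite -catA. Qed.

Lemma unary_point_cylinder s k t :
  cylinder k (unary_point s) (unary_point (s ++ k :: t)).
Proof.
move=> i ik; rewrite /unary_point unary_cat nth_cat.
case: ltnP => // si; rewrite (nth_default _ si) /= nth_cat size_nseq.
have lt : (i - size (unary s) < k)%N by exact: leq_ltn_trans (leq_subr _ _) ik.
by rewrite lt nth_nseq lt.
Qed.

Lemma unary_point_neq s k t : unary_point (s ++ k :: t) <> unary_point s.
Proof.
move=> /(congr1 (fun x => x (size (unary s) + k)%N)).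
rewrite /unary_point unary_cat nth_cat ltnNge leq_addr /= addKn.
by rewrite nth_cat size_nseq ltnn subnn /= nth_default// leq_addr.
Qed.

(** [S] lies in some [upow n] and in a later [upow m]. By [upow_cat], some [s] in [S] has extensions
    [s ++ k :: t] in [S] for almost every [k], and these converge to [s]. *)
Lemma upow_lim_not_discrete S : ultra_lim u upow S ->
  ~ discrete_set (unary_point @` S).
Proof.
move=> uS dS; have {}uS : u [set k | upow k S] := uS.
have [n Sn] := filter_ex uS.
have /filter_ex[m [Sm nm]] : u ([set k | upow k S] `&` [set k | (n < k)%N]).
  by apply: filterI => //; exact: uinf.
have [d dE] : exists d, m = (n + d.+1)%N.
  by exists (m - n.+1)%N; rewrite -addSnnS subnKC.
move: Sm; rewrite /= dE upow_cat => Sm.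
have := upow_ultra n => ?.
have /filter_ex[s [Ss uSs]] :
    upow n (S `&` [set s | upow d.+1 [set t | S (s ++ t)]]).
  exact: filterI.
have /isolatedP[_ [k0 k0P]] : isolated (unary_point @` S) (unary_point s).
  by apply: dS; exists s.
have /filter_ex[k [/= kS kk0]] :
    u ([set k | upow d [set t | S (s ++ k :: t)]] `&` [set k | (k0 <= k)%N]).
  by apply: filterI => //; exact: uSs.
have := upow_ultra d => ?.
have [t St] := filter_ex kS.
apply: (@unary_point_neq s k t); apply: k0P; first by exists (s ++ k :: t).
exact: cylinder_le kk0 _ (@unary_point_cylinder s k t).
Qed.

(** Row [k] converges to [x k], and [x k] to [x0]. If [F] is mostly [x k] on most rows, the image is
    a sequence converging to [x0], either constant or avoiding [x0]. Otherwise the rows are shrunk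
    and all the limits removed, so each point keeps a neighbourhood with finitely many image
    points. *)
Lemma square_discrete (F : nat * nat -> cantor_space) :
  exists2 S, ultra_lim u (fun k => ultra_map (pair k) u) S &
    discrete_set (F @` S).
Proof.
have /choice[x /choice[A AP]] k : exists x A, u A /\
    forall n, exists m, forall j, (m <= j)%N -> A j -> cylinder n x (F (k, j)).
  by have [x [A uA AP]] := ulim (fun j => F (k, j)); exists x, A.
have nearx k n : u [set j | A k j /\ cylinder n (x k) (F (k, j))].
  have [uA /(_ n)[m mP]] := AP k; apply: filterS2 uA (uinf m) => j Aj mj.
  by split=> //; exact: mP.
have [x0 [B uB BP]] := ulim x.
have far y n : ~ cylinder n x0 y -> exists m, forall i, (m <= i)%N -> B i ->
    forall z, cylinder i (x i) z -> ~ cylinder n y z.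
  move=> nxy; have [m mP] := BP n; exists (maxn n m) => i.
  rewrite geq_max => /andP[ni mi] Bi z iz yz; apply: nxy.
  apply: cylinder_trans (mP i mi Bi) _.
  apply: (@cylinder_trans _ _ z); last exact: cylinder_sym.
  exact: cylinder_le ni _ iz.
have [B' [uB' BB' B'P]] : exists B', [/\ u B', B' `<=` B &
    (forall k, B' k -> x k = x0) \/ (forall k, B' k -> x k <> x0)].
  have [h|h] := in_ultra_setVsetC [set k | x k = x0] uU.
    exists (B `&` [set k | x k = x0]); split; first exact: filterI.
      by move=> k [].
    by left=> k [].
  exists (B `&` ~` [set k | x k = x0]); split; first exact: filterI.
    by move=> k [].
  by right=> k [].
have [uc|un] := in_ultra_setVsetC [set k | u [set j | F (k, j) = x k]] uU.
  exists [set p | B' p.1 /\ F p = x p.1].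
    rewrite /ultra_lim /ultra_map /=.
    apply: filterS2 uB' uc => k B'k /=; apply: filterS => j Fj.
    by split.
  apply: discrete_set_finite => y [[k j] [/= B'k Fk] yE].
  case: B'P => B'P.
    exists 0%N; apply: (@sub_finite_set _ _ [set x0]) => //.
    by move=> _ [[[k' j'] [/= B'k' ->] <-] _]; rewrite /= B'P.
  have [|n nxy] := @neq_cylinder x0 y.
    by move=> yx0; apply: (B'P k B'k); rewrite -Fk yE.
  have [m mP] := far y n nxy.
  exists n; apply: (@sub_finite_set _ _ (x @` `I_m)).
    move=> _ [[[k' j'] [/= B'k' Fk'] <-] yk']; rewrite Fk' in yk' *.
    exists k' => //=; rewrite ltnNge; apply/negP => mk'.
    exact: (mP k' mk' (BB' _ B'k') (x k')).
  exact/finite_image/finite_II.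
have un' : u [set k | u [set j | F (k, j) <> x k]].
  apply: filterS un => k nk.
  by have [] := in_ultra_setVsetC [set j | F (k, j) = x k] uU.
exists [set p | [/\ B' p.1, A p.1 p.2, cylinder p.1 (x p.1) (F p),
                    F p <> x0 & forall i, B' i -> F p <> x i]].
  rewrite /ultra_lim /ultra_map /=.
  apply: filterS2 uB' un' => k B'k /= uk.
  case: B'P => B'P.
    have := nearx k k; apply: filterS2 uk => j Fk [Aj kj].
    split=> // [|i B'i]; last by rewrite (B'P i B'i) -(B'P k B'k).
    by rewrite -(B'P k B'k).
  have [n nk] := neq_cylinder (B'P k B'k).
  have [m mP] := far _ _ nk.
  have [n' n'P] := finite_separate (x k) (finite_image x (finite_II m)).
  (* Agreement up to [k] shrinks the row, up to [n] excludes [x0] and [x i] for [i >= m], and up to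
     [n'] the earlier [x i]. *)
  have := nearx k (maxn k (maxn n n')); apply: filterS2 uk => j Fk [Aj kj].
  have knj : cylinder n (x k) (F (k, j)).
    by apply: cylinder_le kj; rewrite !leq_max leqnn orbT.
  have kn'j : cylinder n' (x k) (F (k, j)).
    by apply: cylinder_le kj; rewrite !leq_max leqnn !orbT.
  split=> // [||i B'i Fi].
  - exact: cylinder_le (leq_maxl _ _) _ kj.
  - by move=> F0; apply/nk/cylinder_sym; rewrite -F0.
  - have [im|mi] := ltnP i m.
      apply: Fk; rewrite Fi; apply: n'P; last by rewrite -Fi.
      by exists i.
    by apply: (mP i mi (BB' _ B'i) (x i)) => //; rewrite -Fi.
apply: discrete_set_finite => _ [[k j] [/= B'k Aj _ F0 Fi] <-].
set y := F (k, j).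
have [n0 n0P] := neq_cylinder F0; have [m mP] := far _ _ n0P.
have [n1 n1P] := finite_separate y (finite_image x (finite_II m)).
exists (maxn n0 n1).
apply: (@sub_finite_set _ _ (\bigcup_(i in `I_m) ((fun j => F (i, j)) @`
    [set j | [/\ B' i, A i j & cylinder n1 y (F (i, j))]]))).
  move=> _ [[[i j'] [/= B'i Aj' ij' _ _] <-] yi]; exists i; last first.
    exists j' => //; split=> //; exact: cylinder_le (leq_maxr _ _) _ yi.
  rewrite /= ltnNge; apply/negP => mi.
  by apply: (mP i mi (BB' _ B'i) _ ij'); exact: cylinder_le (leq_maxl _ _) _ yi.
apply: bigcup_finite => [|i im]; first exact: finite_II.
apply: finite_image.
have [B'i|nB'i] := pselect (B' i); last first.
  by apply: (@sub_finite_set _ _ set0) => // j' [].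
have [M MP] := (AP i).2 n1.
apply: (@sub_finite_set _ _ `I_M); last exact: finite_II.
move=> j' [_ Aj' yj'] /=; rewrite ltnNge; apply/negP => Mj'.
apply: (Fi i B'i); apply/esym/n1P; first by exists i.
by apply: cylinder_trans yj' _; apply: cylinder_sym; exact: MP.
Qed.

End convergent.

(** * Measure and category *)

Lemma I_ultrafilter_transfer (T : countType) (u : set_system T)
    (I J : set (set cantor_space)) (e : T -> cantor_space) :
  UltraFilter u ->
  (forall F : T -> cantor_space, exists2 S, u S & I (F @` S)) ->
  (forall A B, A `<=` B -> J B -> J A) ->
  (forall S, u S -> ~ J (e @` S)) ->
  exists v, I_ultrafilter I v /\ ~ I_ultrafilter J v.
Proof.
move=> uU uI JS uJ; exists (ultra_map pickle u); split.
  split; first exact: ultra_map_ultra.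
  move=> F; have [S uS IS] := uI (F \o pickle).
  exists (pickle @` S); last by rewrite image_comp.
  by rewrite /ultra_map /=; apply: filterS uS => t St; exists t.
move=> [_ /(_ (fun n => if unpickle n is Some t then e t else point))].
move=> [A uA JA]; apply: (uJ _ uA); apply: JS JA => _ [t At <-].
by exists (pickle t) => //; rewrite pickleK.
Qed.

Section measure.
Local Open Scope ring_scope.
Variable R : realType.
Local Notation m := (cantor_measure R).

Lemma measurable_open (U : set cantor_space) :
  open U -> measurable (U : set cantor_borel).
Proof. exact: sub_sigma_algebra. Qed.

Lemma measurable_closed (K : set cantor_space) :
  closed K -> measurable (K : set cantor_borel).
Proof.
move=> cK; rewrite -[K]setCK; apply: measurableC.
exact: measurable_open (closed_openC cK).
Qed.

Lemma open_cyl (w : seq bool) : open (cyl w).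
Proof. exact: open_cylinder. Qed.

Lemma open_cyls (L : seq (seq bool)) :
  open [set y : cantor_space | exists2 w, w \in L & cyl w y].
Proof.
apply: open_cylinders => y [w wL wy]; exists (size w) => z yz; exists w => //.
by move=> i iw; rewrite yz// wy.
Qed.

Lemma measure_cyls (L : seq (seq bool)) n :
  (forall w, w \in L -> size w = n) ->
  (m [set y | exists2 w, w \in L & cyl w y] <= ((size L)%:R / 2 ^+ n)%:E)%E.
Proof.
elim: L => [|w L IHL] sz.
  by rewrite (_ : [set _ | _] = set0) ?measure0 ?mul0r//;
    apply/seteqP; split=> // y [].
rewrite (_ : [set _ | _] = cyl w `|` [set y | exists2 w, w \in L & cyl w y]).
  apply: le_trans (measureU2 _ (measurable_open (open_cyl w))
    (measurable_open (open_cyls L))) _.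
  rewrite /= -nat1r mulrDl mul1r EFinD; apply: leeD.
    by rewrite -(sz w (mem_head _ _)) -(cantor_measure_cylinder R _ (nth false w)).
  by apply: IHL => v vL; apply: sz; rewrite inE vL orbT.
apply/seteqP; split=> y.
  by move=> [v + vy]; rewrite inE => /predU1P[<-|]; [left|right; exists v].
move=> [wy|[v vL vy]]; first by exists w; rewrite ?mem_head.
by exists v; rewrite // inE vL orbT.
Qed.

Lemma closure_cyls (Y : set cantor_space) (L : seq (seq bool)) :
  Y `<=` [set y | exists2 w, w \in L & cyl w y] ->
  closure Y `<=` [set y | exists2 w, w \in L & cyl w y].
Proof.
move=> YL z /closure_cylinder H.
have [y /YL[w wL wy] zy] := H (\max_(w <- L) size w)%N.
exists w => // i iw; rewrite -wy// zy//; apply: leq_trans iw _.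
exact: (@leq_bigmax_seq _ _ xpredT size).
Qed.

Lemma measure_zero_setP (T : eqType) (F : T -> cantor_space) (S : set T) :
  (forall k, exists (l : seq T) (L : seq (seq bool)) d,
    [/\ forall w, w \in L -> size w = d, (size L * 2 ^ k <= 2 ^ d)%N &
        forall t, S t -> t \in l \/ exists2 w, w \in L & cyl w (F t)]) ->
  measure_zero_set R (F @` S).
Proof.
move=> H; rewrite /measure_zero_set.
have le k (n d : nat) : (n * 2 ^ k <= 2 ^ d)%N -> n%:R / 2 ^+ d <= (2 ^+ k)^-1 :> R.
  move=> h; rewrite ler_pdivrMr ?exprn_gt0// mulrC ler_pdivlMr ?exprn_gt0//.
  by rewrite -!natrX -natrM ler_nat.
have bound k : (m (closure (F @` S)) <= (2 / 2 ^+ k)%:E)%E.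
  have [l [L [d [Ld Lk SL]]]] := H k.
  (* Cylinders of this length around the exceptional points have total measure at most
     [1 / 2 ^ k]. *)
  pose n := (k + size l)%N; pose L' := [seq mkseq (F t) n | t <- l].
  have sz w : w \in L' -> size w = n by move=> /mapP[t _ ->]; rewrite size_mkseq.
  have sub : closure (F @` S) `<=` [set y | exists2 w, w \in L & cyl w y] `|`
      [set y | exists2 w, w \in L' & cyl w y].
    apply: (@subset_trans _ [set y | exists2 w, w \in L ++ L' & cyl w y]).
      apply: closure_cyls => _ [t St <-]; have [tl|[w wL wt]] := SL t St.
        exists (mkseq (F t) n); last by rewrite -cylE.
        by rewrite mem_cat (map_f (fun t => mkseq (F t) n)) ?orbT.
      by exists w => //; rewrite mem_cat wL.
    by move=> y [w]; rewrite mem_cat => /orP[]; [left|right]; exists w.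
  have mL := measurable_open (open_cyls L).
  have mL' := measurable_open (open_cyls L').
  have mS := measurable_closed (@closed_closure _ (F @` S)).
  have mU := measurableU _ _ mL mL'.
  apply: le_trans (le_measure m (mem_set mS) (mem_set mU) sub) _.
  apply: le_trans (measureU2 m mL mL') _.
  rewrite (_ : 2 / 2 ^+ k = (2 ^+ k)^-1 + (2 ^+ k)^-1); last lra.
  rewrite EFinD; apply: leeD.
    by apply: le_trans (measure_cyls Ld) _; rewrite lee_fin; exact: le.
  apply: le_trans (measure_cyls sz) _; rewrite lee_fin; apply: le.
  by rewrite size_map expnD mulnC leq_mul2l ltnW ?orbT// ltn_expl.
apply/eqP; rewrite eq_le measure_ge0 andbT leNgt; apply/negP.
have fin : m (closure (F @` S)) \is a fin_num.
  by apply: fin_num_measure; exact: measurable_closed (@closed_closure _ _).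
rewrite -(fineK fin) lte_fin => r0.
have r2 : 0 < fine (m (closure (F @` S))) / 2 by rewrite divr_gt0.
have [N _ /(_ N (leqnn N)) /= NP] := near_infty_natSinv_lt (PosNum r2).
have := bound N; rewrite -(fineK fin) lee_fin.
have : (2 ^+ N)^-1 <= N.+1%:R^-1 :> R.
  by rewrite lef_pV2 ?posrE ?exprn_gt0 ?ltr0n// -natrX ler_nat ltn_expl.
move: NP; rewrite /=; set a := N.+1%:R^-1; set b := (2 ^+ N)^-1; set c := fine _.
by lra.
Qed.

Definition level_set (n : nat) (A : set (seq bool)) : set cantor_space :=
  [set y | A (mkseq y n)].

Lemma measurable_level_set n A :
  measurable (level_set n A : set cantor_borel).
Proof.
apply: measurable_open; apply: open_cylinders => y Ay; exists n => z yz.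
rewrite /level_set /= (_ : mkseq z n = mkseq y n)//.
by apply/eq_in_map => i; rewrite mem_iota => /yz.
Qed.

(* The proportion of the words of length [n] that lie in [A]; as the measure of *)
(* a set it is additive for free.                                              *)
Definition level_density (n : nat) (A : set (seq bool)) : R :=
  fine (m (level_set n A)).

Let fin n A : m (level_set n A) \is a fin_num.
Proof. by apply: fin_num_measure; exact: measurable_level_set. Qed.

Lemma level_density0 n : level_density n set0 = 0.
Proof. by rewrite /level_density /level_set measure0. Qed.

Lemma level_densityT n : level_density n setT = 1.
Proof. by rewrite /level_density /level_set probability_setT. Qed.

Lemma level_densityS n A B : A `<=` B -> level_density n A <= level_density n B.
Proof.
move=> AB; apply: fine_le => //; apply: le_measure; rewrite ?inE.
- exact: measurable_level_set.
- exact: measurable_level_set.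
- by move=> y /AB.
Qed.

Lemma level_densityU n A B : A `&` B = set0 ->
  level_density n (A `|` B) = level_density n A + level_density n B.
Proof.
move=> AB; rewrite /level_density -fineD//; congr fine.
rewrite -measureU//; [exact: measurable_level_set|exact: measurable_level_set|].
apply/seteqP; split=> // y [Ay By].
by have : (A `&` B) (mkseq y n) by []; rewrite AB.
Qed.

Lemma level_density_fin n : exists l : seq (seq bool), forall A,
  level_density n (A `&` [set` l]) = level_density n A.
Proof.
exists [seq val t | t <- enum {: n.-tuple bool}] => A.
congr (fine (m _)); apply/seteqP; split=> [y []//|y Ay]; split=> //=.
have sz : size (mkseq y n) == n by rewrite size_mkseq.
by apply/mapP; exists (Tuple sz); rewrite ?mem_enum.
Qed.

(** The closure is the decreasing intersection of the sets [K n]. Each contains [level_set n' A] for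
    a later level [n'] of density at least [r], and the measure is continuous from above. *)
Lemma dense_positive_closure A : dense_positive level_density A ->
  ~ measure_zero_set R ((nth false : seq bool -> cantor_space) @` A).
Proof.
move=> /(dense_positiveE level_density)[r r0 H]; rewrite /measure_zero_set.
set Y := _ @` A.
pose K n : set cantor_space := [set z | exists2 y, Y y & cylinder n y z].
have mK n : measurable (K n : set cantor_borel).
  apply: measurable_open; apply: open_cylinders => z [y Yy yz]; exists n => z' zz'.
  by exists y => //; exact: cylinder_trans zz'.
have -> : closure Y = \bigcap_n K n.
  apply/seteqP; split=> z.
    move=> /closure_cylinder Hz n _; have [y Yy zy] := Hz n.
    by exists y => //; exact: cylinder_sym.
  move=> Kz; apply/closure_cylinder => n; have [y Yy yz] := Kz n I.
  by exists y => //; exact: cylinder_sym.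
have rK n : (r%:E <= m (K n))%E.
  have [n' nn' rn'] := H n.
  apply: (@le_trans _ _ (m (level_set n' A))).
    by rewrite -(fineK (fin n' A)) lee_fin.
  apply: le_measure; rewrite ?inE//; first exact: measurable_level_set.
  move=> y Ay; exists (nth false (mkseq y n')); first by exists (mkseq y n').
  by move=> i ni; rewrite nth_mkseq//; exact: leq_trans nn'.
have niK : nonincreasing_seq K.
  move=> n n' nn'; apply/subsetPset => z [y Yy yz]; exists y => //.
  exact: cylinder_le nn' _ yz.
have cvK : (m \o K) n @[n --> \oo] --> m (\bigcap_n K n).
  apply: nonincreasing_cvg_mu => //; last exact: bigcapT_measurable.
  by apply: le_lt_trans (probability_le1 m (mK 0%N)) _; rewrite ltry.
move=> mK0; rewrite mK0 in cvK.
have : (r%:E <= 0)%E.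
  rewrite -(cvg_lim _ cvK)//; apply: lime_ge; first by apply/cvg_ex; exists 0%E.
  by apply: nearW => n; exact: rK.
by rewrite lee_fin; lra.
Qed.

End measure.

Lemma nowhere_dense_setP (T : eqType) (F : T -> cantor_space) (S : set T) :
  (forall c, exists (l : seq T) w,
    forall t, S t -> t \in l \/ ~ cyl (c ++ w) (F t)) ->
  nowhere_dense_set (F @` S).
Proof.
move=> H; apply/seteqP; split=> // z /nbhs_cylinder[n nY].
have [l [w lw]] := H (mkseq z n); set c := mkseq z n ++ w in lw.
(* Each exceptional point is avoided by one further bit. *)
have [v vP] : exists v, forall t, t \in l -> ~ cyl (c ++ v) (F t).
  elim: l {lw} => [|t l [v vP]]; first by exists [::].
  exists (rcons v (~~ F t (size (c ++ v)))) => t'; rewrite -rcons_cat inE.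
  move=> /predU1P[->|tl] Ft.
    have := Ft (size (c ++ v)); rewrite size_rcons => /(_ (ltnSn _)).
    by rewrite nth_rcons ltnn eqxx; case: (F t _).
  by apply: (vP t' tl); move: Ft; rewrite -cats1 => /cyl_cat[].
pose y : cantor_space := nth false (c ++ v).
have cy : cyl (c ++ v) y by [].
have /closure_cylinder /(_ (size (c ++ v)))[_ [t St <-] yt] : closure (F @` S) y.
  by apply: nY; rewrite cylE; have /cyl_cat[/cyl_cat[]] := cy.
have [tl|] := lw t St; first exact: (vP t tl).
by apply; have /cyl_cat[] : cyl (c ++ v) (F t) by exact: yt.
Qed.

(** * The four separations *)

Theorem theorem1p4 (R : realType) :
  MA_sigma_centered ->
  [/\ (exists u : set_system nat, discrete_ultrafilter u /\ ~ P_point u),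
      (exists u : set_system nat,
         scattered_ultrafilter u /\ ~ discrete_ultrafilter u),
      (exists u : set_system nat,
         measure_zero_ultrafilter R u /\ ~ scattered_ultrafilter u) &
      (exists u : set_system nat,
         nowhere_dense_ultrafilter u /\ ~ measure_zero_ultrafilter R u)].
Proof.
move=> MA; have [u [uU uinf ulim]] := convergent_ultrafilter MA.
split.
- pose u2 := ultra_lim u (fun k => ultra_map (pair k) u).
  have u2U : UltraFilter u2 by apply: ultra_lim_ultra => k; exact: ultra_map_ultra.
  exists (ultra_map pickle u2); split.
    split; first exact: ultra_map_ultra.
    move=> F; have [S uS dS] := square_discrete uU uinf ulim (F \o pickle).
    exists (pickle @` S); last by rewrite image_comp.
    by rewrite /ultra_map /=; apply: filterS uS => t St; exists t.
  pose code (k j : nat) : nat := pickle (k, j).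
  have codeI k k' j j' : code k j = code k' j' -> k = k' /\ j = j'.
    by move=> /(pcan_inj pickleK)[-> ->].
  (* The sets omit the first [n] rows. A pseudo-intersection would meet every row in a finite set,
     but a member of [u2] has a row in [u], hence an unbounded one. *)
  move=> [_ /(_ (fun n => [set i | exists k j, (n <= k)%N /\ i = code k j]))].
  case=> [n|B uB finB].
    rewrite /u2 /ultra_lim /ultra_map /=.
    apply: filterS (uinf n) => k nk /=; apply: filterS (uinf 0%N) => j _.
    by exists k, j.
  have /filter_ex[k Bk] : u [set k | u (code k @^-1` B)] := uB.
  have /finite_seqP[l lE] : finite_set (code k @^-1` B).
    have fI : {in code k @^-1` (B `\` [set i | exists k' j, (k < k')%N /\
        i = code k' j]) &, injective (code k)} by move=> i j _ _ /codeI[].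
    apply: sub_finite_set (finite_preimage fI (finB k.+1)) => j Bj; split=> //.
    by move=> [k' [j' [kk' /codeI[kE _]]]]; rewrite kE ltnn in kk'.
  have /filter_ex[j [Bj]] : u (code k @^-1` B `&`
      [set j | ((\max_(i <- l) i).+1 <= j)%N]) by exact: filterI.
  rewrite /= ltnNge => /negP; apply; apply: (@leq_bigmax_seq _ _ xpredT id) => //.
  by have : [set` l] j by rewrite -lE.
- apply: (@I_ultrafilter_transfer _ (ultra_lim u (upow u)) _ _ unary_point).
  + by apply: ultra_lim_ultra => n; exact: upow_ultra.
  + by apply: scattering_lim => // n; [exact: upow_ultra|exact: upow_scattering].
  + exact: discrete_setS.
  + by move=> S; exact: upow_lim_not_discrete.
- have [||v [vU vP vF]] := @null_ultrafilter (seq nat) unary_point MA.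
  + by exists [::].
  + move=> s _ n; exists (s ++ [:: n]); split=> //.
      exact: unary_point_neq.
    exact: unary_point_cylinder.
  + apply: (@I_ultrafilter_transfer _ v _ _ unary_point) => //.
    * by move=> F; have [S vS FS] := vF F; exists S => //; exact: measure_zero_setP.
    * exact: scattered_setS.
    * by move=> S /vP; exact: unscattered_image.
- have [v [vU vP vF]] := nwd_ultrafilter (level_density0 R) (level_densityT R)
    (@level_densityS R) (@level_densityU R) (level_density_fin R) MA.
  apply: (@I_ultrafilter_transfer _ v _ _ (nth false)) => //.
  + by move=> F; have [S vS FS] := vF F; exists S => //; exact: nowhere_dense_setP.
  + exact: measure_zero_setS.
  + by move=> S /vP; exact: dense_positive_closure.
Qed.
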